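(* Let $k$ be a field of characteristic $p$ ($p=0$ or $p$ prime), let $G$ be a finite group, and let $\mathcal{M}=\{M_1,\ldots,M_\ell\}$ be a set of distinct subgroups of $G$ such that: (1) the union $H=\bigcup_i M_i$ is a subgroup of $G$; (2) each $M_i$ is a proper subgroup of $H$; (3) each cyclic mod $p$ subgroup $C\subset H$ is contained in $M_i$ for some $i$. Let $\mathcal{J}_e$ (resp. $\mathcal{J}_o$) be the set of non-empty subsets of $\{1,\ldots,\ell\}$ of even (resp. odd) cardinality, for non-empty $S\subset\{1,\dots,\ell\}$ put $M_S=\bigcap_{i\in S}M_i$, and define the $G$-sets $$X_{\mathcal{M}}=\#H\cdot (G/H)\ \sqcup\ \bigsqcup_{S\in\mathcal{J}_e}\#M_S\cdot (G/M_S),\qquad Y_{\mathcal{M}}=\bigsqcup_{S\in\mathcal{J}_o}\#M_S\cdot (G/M_S).$$ Then $X_{\mathcal{M}}$ and $Y_{\mathcal{M}}$ are linearly equivalent over $k$.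
   Context: For a $G$-set $Z$ and a non-negative integer $n$, $n\cdot Z$ denotes the disjoint union of $n$ copies of $Z$. For a $G$-set $X$, $k[X]$ denotes the permutation module of maps $X\to k$, a module over the group algebra $kG$. Two finite $G$-sets $X,Y$ are linearly equivalent over $k$ if $k[X]\cong k[Y]$ as $kG$-modules. For $p$ prime, a finite group is called cyclic mod $p$ if it has a normal $p$-subgroup with cyclic quotient; ''cyclic mod $0$'' means cyclic. *)

(* Defs.v *)
From mathcomp Require Import all_boot all_order all_fingroup all_algebra all_solvable.

Set Implicit Arguments.
Unset Strict Implicit.
Unset Printing Implicit Defensive.

Import GroupScope GRing.Theory.

(* Actions are right actions, as in the MathComp library: G-sets are right
   G-sets, G/K is the set of right cosets of K, and kG-modules are right
   modules. Inversion in G exchanges these with the left-handed notions. *)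

Record gset (gT : finGroupType) (G : {group gT}) := GSet {
  gset_sort :> finType;
  gset_act : action G gset_sort }.

Section GSets.

Variables (gT : finGroupType) (G : {group gT}).

Section Cosets.

Variable K : {group gT}.

Lemma rcosets_act :
  G \subset subact_dom (fun A : {set gT} => A \in rcosets K G) 'Rs.
Proof.
have := actsRs_rcosets K G.
rewrite /subact_dom; set S := [set x | _]; suff -> : S = rcosets K G.
  by [].
by apply/setP=> A; rewrite inE.
Qed.

Definition coset_gset : gset G :=
  GSet ('Rs^?%act \ rcosets_act
          : action G {A : {set gT} | A \in rcosets K G}).

Lemma coset_gsetE (u : coset_gset) g :
  g \in G -> val (gset_act coset_gset u g) = val u :* g.
Proof.
by move=> Gg; rewrite [LHS]val_subact (subsetP rcosets_act) //= rcosetE.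
Qed.

End Cosets.

Section Union.

Variables X Y : gset G.

Definition union_act (z : X + Y) (g : gT) : X + Y :=
  match z with
  | inl x => inl (gset_act X x g)
  | inr y => inr (gset_act Y y g)
  end.

Lemma union_is_action : is_action G union_act.
Proof.
split=> [g [x|y] [x'|y'] // [] /act_inj -> // | [x|y] g h Gg Gh /=];
  by rewrite actMin.
Qed.

Definition gset_union : gset G := GSet (Action union_is_action).

End Union.

Section BigUnion.

Variables (I : finType) (F : I -> gset G).

Definition bigunion_act (z : {i : I & F i}) (g : gT) : {i : I & F i} :=
  Tagged (fun i => F i) (gset_act (F (tag z)) (tagged z) g).

Lemma bigunion_is_action : is_action G bigunion_act.
Proof.
split=> [g [i x] [j y] eq_ij | [i x] g h Gg Gh]; last first.
  by rewrite /bigunion_act /= actMin.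
have /= eqij := congr1 tag eq_ij; case: _ / eqij y eq_ij => y.
by move/eqP; rewrite eq_Tagged => /eqP /= /act_inj ->.
Qed.

Definition gset_bigunion : gset G := GSet (Action bigunion_is_action).

End BigUnion.

Definition gset_copies (n : nat) (Z : gset G) : gset G :=
  gset_bigunion (fun _ : 'I_n => Z).

Section PermutationModule.

Local Open Scope ring_scope.

Variable k : fieldType.

(* k^o is k viewed as a module over itself, so that this is a k-module. *)
Definition perm_mod (X : gset G) := {ffun X -> k^o}.

Definition perm_mod_act (X : gset G) (f : perm_mod X) (g : gT) : perm_mod X :=
  [ffun x => f (gset_act X x g^-1%g)].

Lemma perm_mod_act1 (X : gset G) (f : perm_mod X) : perm_mod_act f 1%g = f.
Proof. by apply/ffunP=> x; rewrite ffunE invg1 act1. Qed.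

Lemma perm_mod_actM (X : gset G) (f : perm_mod X) g h :
  g \in G -> h \in G ->
  perm_mod_act f (g * h)%g = perm_mod_act (perm_mod_act f g) h.
Proof.
by move=> Gg Gh; apply/ffunP=> x; rewrite !ffunE invMg actMin ?groupV.
Qed.

Lemma perm_mod_act_is_linear (X : gset G) g :
  linear (fun f : {ffun X -> k^o} => perm_mod_act f g : {ffun X -> k^o}).
Proof. by move=> a f f'; apply/ffunP=> x; rewrite !ffunE. Qed.

Definition linearly_equivalent (X Y : gset G) : Prop :=
  exists2 phi : {linear {ffun X -> k^o} -> {ffun Y -> k^o}},
    bijective phi &
    forall (g : gT) (f : perm_mod X),
      g \in G -> phi (perm_mod_act f g) = perm_mod_act (phi f) g.

End PermutationModule.

End GSets.

Definition has_characteristic (k : fieldType) (p : nat) : Prop :=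
  if p is 0%N then [pchar k]%R =i pred0 else p \in [pchar k]%R.

Definition cyclic_mod (gT : finGroupType) (p : nat) (C : {group gT}) : Prop :=
  if p is 0%N then cyclic C
  else exists P : {group gT}, [/\ P <| C, p.-group P & cyclic (C / P)].

Section XY.

Variables (gT : finGroupType) (G : {group gT}).
Variables (l : nat) (M : 'I_l -> {group gT}).

Definition M_ (S : {set 'I_l}) : {group gT} := (\bigcap_(i in S) M i)%G.

Definition J_e : finType := {S : {set 'I_l} | (S != set0) && ~~ odd #|S|}.
Definition J_o : finType := {S : {set 'I_l} | (S != set0) && odd #|S|}.

Definition X_ (H : {group gT}) : gset G :=
  gset_union (gset_copies #|H| (coset_gset G H))
    (gset_bigunion
       (fun S : J_e => gset_copies #|M_ (val S)| (coset_gset G (M_ (val S))))).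

Definition Y_ : gset G :=
  gset_bigunion
    (fun S : J_o => gset_copies #|M_ (val S)| (coset_gset G (M_ (val S)))).

End XY.

(* Main.v *)
(* By inclusion-exclusion a subgroup C of G has as many fixed points on X_ as on
   Y_ as soon as every conjugate of C lying in H lies in some M_i, in particular
   when C is cyclic mod p. It remains to prove that G-sets X and Y with the same
   numbers of fixed points under the subgroups that are cyclic mod p are
   linearly equivalent. For p = 0 this follows from character theory.

   For p prime we show that, for every G-module V over a field of
   characteristic p, the spaces of equivariant maps from X and from Y to V have
   the same dimension; over F_p, counting the equivariant maps whose values span
   a given submodule then yields a surjective, hence bijective, homomorphism
   k[X] -> k[Y]. In terms of the difference w of X and Y, a virtual G-set with
   e(K) points of stabiliser K, we need f(V) = sum_K e(K) |K| dim V^K to vanish.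
   We prove it by induction on the index of Q for w and V on which a normal
   p-subgroup Q of G acts trivially.
   - f is additive on exact sequences V1 -> V2 -> V3. The defect is the
     contribution of the cohomological Mackey functor K |-> V3^K / im V2^K, which
     vanishes at Q. Such a functor has a filtration whose quotients are
     concentrated at the conjugates of a p-subgroup R strictly containing Q,
     with values images of relative traces from R; their contributions are
     governed by the N_G(R)-set of fixed points of R, and vanish by induction.
   - f(V tensor k[Z]) is the sum over z in Z of the contributions of the
     restrictions of w and V to the stabiliser of z, and w restricted to a
     subgroup that is cyclic mod p is zero by Burnside's theorem.
   - Apply this to the sets Z = X_ and Z = Y_ for H = G and the family of all
     subgroups C containing Q with C / Q cyclic: they have the same permutation
     character, so there is an integral intertwiner between Z[X_] and Z[Y_] with
     nonzero determinant. Putting it in Smith normal form and dividing it by p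
     step by step shows that f(V tensor k[X_]) = f(V tensor k[Y_]) by
     additivity, and this reads n f(V) = 0 with n > 0. *)

From HB Require Import structures.
Require Import Defs.
From mathcomp Require Import all_boot all_order all_fingroup all_algebra all_solvable.
From mathcomp Require Import all_field all_character.
From mathcomp Require Import zify ring.

Set Implicit Arguments.
Unset Strict Implicit.
Unset Printing Implicit Defensive.

Import GroupScope GRing.Theory Num.Theory.

(** * Sums over cosets *)

Section CosetSums.

Local Open Scope ring_scope.

Variables (gT : finGroupType) (W : zmodType).
Implicit Types (K L J : {group gT}) (h : gT -> W).

Lemma repr_rcosets K L (C : {set gT}) : L \subset K -> C \in rcosets L K ->
  repr C \in K /\ L :* repr C = C.
Proof.
move=> sLK /rcosetsP[g Kg ->]; rewrite rcoset_repr; split=> //.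
by case: repr_rcosetP => l Ll; rewrite groupM // (subsetP sLK).
Qed.

(** The hypothesis makes [h] constant on the right cosets of L, so that sums of [h (repr C)] do not
    depend on the representatives. It will be applied to [h x = r x v] with v fixed by L. *)
Lemma rcoset_inv_repr K L h g : {in L & K, forall l x, h (l * x)%g = h x} ->
  g \in K -> h (repr (L :* g)) = h g.
Proof. by move=> hL Kg; case: repr_rcosetP => l Ll; rewrite hL. Qed.

Lemma rcosets_sum_translate K L h g :
    L \subset K -> {in L & K, forall l x, h (l * x)%g = h x} -> g \in K ->
  \sum_(C in rcosets L K) h (repr C * g)%g = \sum_(C in rcosets L K) h (repr C).
Proof.
move=> sLK hL Kg.
have img : [set C :* g | C in rcosets L K] = rcosets L K.
  apply/setP=> D; apply/imsetP/rcosetsP=> [[_ /rcosetsP[x Kx ->] ->]|[x Kx ->]].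
    by exists (x * g)%g; rewrite ?groupM // -rcosetM.
  exists (L :* (x * g^-1)%g); last by rewrite -rcosetM mulgKV.
  by apply/rcosetsP; exists (x * g^-1)%g; rewrite // groupM ?groupV.
rewrite -[in RHS]img [RHS]big_imset /=; last first.
  by move=> C D _ _ /= /rcoset_inj.
apply: eq_bigr => C LC; have [Kr defC] := repr_rcosets sLK LC.
by rewrite -{2}defC -rcosetM (rcoset_inv_repr hL) ?groupM.
Qed.

Lemma rcosets_sum_tower K L J h :
    L \subset J -> J \subset K -> {in L & K, forall l x, h (l * x)%g = h x} ->
  \sum_(D in rcosets J K) \sum_(C in rcosets L J) h (repr C * repr D)%g =
  \sum_(C in rcosets L K) h (repr C).
Proof.
move=> sLJ sJK hL; have sLK := subset_trans sLJ sJK.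
rewrite [RHS](partition_big (fun C : {set gT} => J :* repr C)
  (mem (rcosets J K))) /=; last first.
  move=> C /(repr_rcosets sLK)[Kr _].
  by apply/rcosetsP; exists (repr C).
apply: eq_bigr => D /(repr_rcosets sJK)[Kd defD].
have img : [set C :* repr D | C in rcosets L J] =
           [set C in rcosets L K | J :* repr C == D].
  apply/setP=> C; rewrite inE; apply/imsetP/andP.
    case=> _ /rcosetsP[j Jj ->] ->; rewrite -rcosetM; split.
      by apply/rcosetsP; exists (j * repr D)%g; rewrite // groupM // (subsetP sJK).
    apply/eqP; rewrite -[RHS]defD; case: repr_rcosetP => l Ll.
    by rewrite mulgA rcosetM rcoset_id // groupM // (subsetP sLJ).
  case=> /(repr_rcosets sLK)[Kc defC] /eqP defD'.
  have : repr C \in J :* repr D by rewrite defD -defD' rcoset_refl.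
  case/rcosetP=> j Jj eqC; exists (L :* j); last by rewrite -rcosetM -eqC defC.
  by apply/rcosetsP; exists j.
rewrite [RHS](eq_bigl (mem [set C :* repr D | C in rcosets L J])); last first.
  by move=> C; rewrite /= img inE.
rewrite [RHS]big_imset /=; last first.
  by move=> C C' _ _ /= /rcoset_inj.
apply: eq_bigr => C /(repr_rcosets sLJ)[Jc defC].
by rewrite -{2}defC -rcosetM (rcoset_inv_repr hL) ?groupM // (subsetP sJK).
Qed.

Lemma rcosets_sum_conj K L h g :
    L \subset K -> {in L & K, forall l x, h (l * x)%g = h x} ->
  \sum_(C in rcosets (L :^ g) (K :^ g)) h (repr C ^ g^-1)%g =
  \sum_(C in rcosets L K) h (repr C).
Proof.
move=> sLK hL.
have -> : rcosets (L :^ g) (K :^ g) = [set C :^ g | C : {set gT} in rcosets L K].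
  apply/setP=> D; apply/rcosetsP/imsetP=> [[x]|[_ /rcosetsP[x Kx ->] ->]].
    rewrite mem_conjg => Kx ->; exists (L :* (x ^ g^-1)%g).
      by apply/rcosetsP; exists (x ^ g^-1)%g.
    by rewrite conjsMg conjg_set1 conjgKV.
  by exists (x ^ g)%g; rewrite ?memJ_conjg // conjsMg conjg_set1.
rewrite [LHS]big_imset /=; last by move=> C D _ _ /conjsg_inj.
apply: eq_bigr => C /(repr_rcosets sLK)[Kc defC].
rewrite -{1}defC conjsMg conjg_set1.
case: (@repr_rcosetP _ (L :^ g)%G) => l; rewrite mem_conjg => Ll.
by rewrite conjMg conjgK hL.
Qed.

(* The orbit of the coset [L :* g] under right translation by J is in bijection
   with the cosets in J of its stabiliser [L :^ g :&: J]. *)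
Lemma rcosets_orbit_sum K L J h g :
    L \subset K -> J \subset K -> g \in K ->
    {in L & K, forall l x, h (l * x)%g = h x} ->
  \sum_(C in orbit 'Rs J (L :* g)) h (repr C) =
  \sum_(C in rcosets (L :^ g :&: J) J) h (g * repr C)%g.
Proof.
move=> sLK sJK Kg hL; have sLJ : L :^ g :&: J \subset J by apply: subsetIr.
have img : orbit 'Rs J (L :* g) =
    [set L :* (g * repr C)%g | C in rcosets (L :^ g :&: J) J].
  apply/setP=> C; apply/imsetP/imsetP=> [[j Jj ->]|].
    exists ((L :^ g :&: J) :* j); first by apply/rcosetsP; exists j.
    rewrite /= rcosetE -rcosetM.
    case: (@repr_rcosetP _ (L :^ g :&: J)%G) => l /setIP[Ll _].
    apply: rcoset_eqP; rewrite mem_rcoset.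
    have -> : (g * j * (g * (l * j))^-1 = (l ^ g^-1)^-1)%g.
      by rewrite /conjg !invMg !invgK -!mulgA mulKVg.
    by rewrite groupV -mem_conjg.
  case=> D /(@repr_rcosets J (L :^ g :&: J)%G _ sLJ)[Jr defD] ->.
  by exists (repr D); rewrite //= rcosetE -rcosetM.
rewrite img [LHS]big_imset /=; last first.
  move=> C D /(@repr_rcosets J (L :^ g :&: J)%G _ sLJ)[Jc defC].
  move=> /(@repr_rcosets J (L :^ g :&: J)%G _ sLJ)[Jd defD] /rcoset_eqP.
  rewrite mem_rcoset => Lcd; rewrite -defC -defD; apply: rcoset_eqP.
  rewrite mem_rcoset; apply/setIP; split; last by rewrite groupM ?groupV.
  rewrite mem_conjg.
  by move: Lcd; rewrite /conjg !invMg invgK !mulgA.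
apply: eq_bigr => C /(@repr_rcosets J (L :^ g :&: J)%G _ sLJ)[Jc _].
by rewrite (rcoset_inv_repr hL) // groupM // (subsetP sJK).
Qed.

End CosetSums.

(** * Representations, fixed points and relative traces *)

Section Representations.

Local Open Scope ring_scope.

Variables (F : fieldType) (gT : finGroupType) (V : vectType F).
Implicit Types (r : gT -> 'End(V)) (G K L J : {group gT}) (U : {vspace V}).

(** The order of composition is that of a right module; nothing is asked of [r] outside G. *)
Definition is_rep (G : {set gT}) r :=
  r 1%g = \1%VF /\ {in G &, forall g h, r (g * h)%g = (r h \o r g)%VF}.

Definition fixv r (K : {set gT}) : {vspace V} :=
  (\bigcap_(g in K) lker (r g - \1%VF))%VS.

(** On vectors fixed by L this is the relative trace (transfer) from L to K, independent of the
    representatives. As an endomorphism of V it can be applied to subspaces. *)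
Definition rtr r (L K : {set gT}) : 'End(V) := \sum_(C in rcosets L K) r (repr C).

Lemma fixvP r (K : {set gT}) v :
  reflect {in K, forall g, r g v = v} (v \in fixv r K).
Proof.
rewrite memvE; apply: (iffP subv_bigcapP) => fixKv g Kg.
  by have := fixKv g Kg; rewrite -memvE => /eqlfunP; rewrite id_lfunE.
by rewrite -memvE; apply/eqlfunP; rewrite id_lfunE fixKv.
Qed.

Lemma fixvS r (L K : {set gT}) : L \subset K -> (fixv r K <= fixv r L)%VS.
Proof.
move=> sLK; apply/subvP=> v /fixvP fixv; apply/fixvP=> g Lg.
exact/fixv/(subsetP sLK).
Qed.

Lemma rtrE r L K v : rtr r L K v = \sum_(C in rcosets L K) r (repr C) v.
Proof. by rewrite sum_lfunE. Qed.

Variables (G : {group gT}) (r : gT -> 'End(V)).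
Hypothesis repG : is_rep G r.

Lemma is_repS (A : {set gT}) : A \subset G -> is_rep A r.
Proof.
case: repG => r1 rM sAG; split=> // g h Ag Ah.
by rewrite rM // (subsetP sAG).
Qed.

Lemma rep1 v : r 1%g v = v. Proof. by case: repG => -> _; rewrite id_lfunE. Qed.

Lemma repM g h v : g \in G -> h \in G -> r (g * h)%g v = r h (r g v).
Proof. by case: repG => _ rM Gg Gh; rewrite rM // comp_lfunE. Qed.

Lemma repK g v : g \in G -> r g^-1%g (r g v) = v.
Proof. by move=> Gg; rewrite -repM ?groupV // mulgV rep1. Qed.

Lemma repKV g v : g \in G -> r g (r g^-1%g v) = v.
Proof. by move=> Gg; rewrite -repM ?groupV // mulVg rep1. Qed.

Lemma fixv_conj K g v : K \subset G -> g \in G ->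
  v \in fixv r K -> r g v \in fixv r (K :^ g).
Proof.
move=> sKG Gg /fixvP fixKv; apply/fixvP=> _ /imsetP[k Kk ->].
have Gk := subsetP sKG k Kk.
by rewrite -repM ?groupJ // -conjgC repM // fixKv.
Qed.

Lemma fixv_left_inv L K v : L \subset K -> K \subset G -> v \in fixv r L ->
  {in L & K, forall l x, r (l * x)%g v = r x v}.
Proof.
move=> sLK sKG /fixvP fixLv l x Ll Kx.
have sLG := subset_trans sLK sKG.
by rewrite repM ?(subsetP sLG l Ll) ?(subsetP sKG x Kx) // fixLv.
Qed.

Lemma rtr_fixv L K v : L \subset K -> K \subset G ->
  v \in fixv r L -> rtr r L K v \in fixv r K.
Proof.
move=> sLK sKG fixLv; apply/fixvP=> g Kg; rewrite !rtrE linear_sum /=.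
rewrite -[RHS](rcosets_sum_translate sLK (fixv_left_inv sLK sKG fixLv) Kg).
apply: eq_bigr => C /(repr_rcosets sLK)[Kr _].
by rewrite repM ?(subsetP sKG).
Qed.

Lemma rtr_index L K v : L \subset K -> v \in fixv r K ->
  rtr r L K v = v *+ #|K : L|.
Proof.
move=> sLK /fixvP fixKv; rewrite rtrE -sumr_const.
by apply: eq_bigr => C /(repr_rcosets sLK)[Kr _]; rewrite fixKv.
Qed.

Lemma rtr_tower L J K v : L \subset J -> J \subset K -> K \subset G ->
  v \in fixv r L -> rtr r J K (rtr r L J v) = rtr r L K v.
Proof.
move=> sLJ sJK sKG fixLv; have sLK := subset_trans sLJ sJK.
rewrite !rtrE -(rcosets_sum_tower sLJ sJK (fixv_left_inv sLK sKG fixLv)).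
apply: eq_bigr => D /(repr_rcosets sJK)[Kd _]; rewrite linear_sum /=.
apply: eq_bigr => C /(repr_rcosets sLJ)[Jc _].
by rewrite repM ?(subsetP sKG _ Kd) ?(subsetP (subset_trans sJK sKG) _ Jc).
Qed.

Lemma rtr_conj L K g v : L \subset K -> K \subset G -> g \in G ->
  v \in fixv r L -> r g (rtr r L K v) = rtr r (L :^ g) (K :^ g) (r g v).
Proof.
move=> sLK sKG Gg fixLv; rewrite rtrE (@rtrE _ (L :^ g)%G (K :^ g)%G).
rewrite -(rcosets_sum_conj g sLK (fixv_left_inv sLK sKG fixLv)) linear_sum /=.
apply: eq_bigr => C.
have sLKg : L :^ g \subset K :^ g by rewrite conjSg.
case/(@repr_rcosets _ (K :^ g)%G (L :^ g)%G _ sLKg).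
rewrite mem_conjg => Kr _; have Gr := subsetP sKG _ Kr.
have Gc : repr C \in G by rewrite -(conjgKV g (repr C)) groupJ.
by rewrite -(repM v Gr Gg) -(repM v Gg Gc) conjgE invgK !mulgA mulgKV.
Qed.

(* Mackey's formula, in the weak form of a membership criterion. *)
Lemma rcosets_sum_sub U L K J (S : {set {set gT}}) v :
    L \subset K -> J \subset K -> K \subset G -> v \in fixv r L ->
    S \subset rcosets L K -> [acts J, on S | 'Rs] ->
    {in K, forall g, L :* g \in S -> rtr r (L :^ g :&: J) J (r g v) \in U} ->
  \sum_(C in S) r (repr C) v \in U.
Proof.
move=> sLK sJK sKG fixLv sS actS trU.
rewrite (set_partition_big _ (orbit_partition actS)) /=.
apply: memv_suml => _ /imsetP[C SC ->].
have /rcosetsP[g Kg defC] := subsetP sS C SC.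
rewrite defC (rcosets_orbit_sum sLK sJK Kg (fixv_left_inv sLK sKG fixLv)).
suff <- : rtr r (L :^ g :&: J) J (r g v) =
    \sum_(E in rcosets (L :^ g :&: J) J) r (g * repr E)%g v.
  by apply: trU; rewrite // -defC.
have sLJ : L :^ g :&: J \subset J by apply: subsetIr.
rewrite (@rtrE _ (L :^ g :&: J)%G J); apply: eq_bigr => E.
case/(@repr_rcosets _ J (L :^ g :&: J)%G _ sLJ) => Jr _.
by rewrite repM ?(subsetP sKG _ Kg) ?(subsetP (subset_trans sJK sKG) _ Jr).
Qed.

Lemma rtr_sub U L K J v :
    L \subset K -> J \subset K -> K \subset G -> v \in fixv r L ->
    {in K, forall g, rtr r (L :^ g :&: J) J (r g v) \in U} ->
  rtr r L K v \in U.
Proof.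
move=> sLK sJK sKG fixLv trU; rewrite rtrE.
apply: (rcosets_sum_sub sLK sJK sKG fixLv) => // [|g Kg _]; last exact: trU.
exact: subset_trans sJK (actsRs_rcosets _ _).
Qed.

End Representations.

(** * Virtual G-sets without fixed points *)

(** A criterion inside C itself, from which the cases of joins and conjugates are immediate. *)
Lemma cyclic_quotientP (gT : finGroupType) (P C : {group gT}) : P <| C ->
  reflect (exists2 x, x \in C & C \subset P <*> <[x]>) (cyclic (C / P)).
Proof.
move=> /andP[sPC nPC]; apply: (iffP idP) => [/cyclicP[xbar defCP] | [x Cx sCPx]].
  have xbarCP : xbar \in C / P by rewrite defCP cycle_id.
  have [x Nx Cx defx] := morphimP xbarCP; exists x => //.
  rewrite -(quotientSGK nPC (joing_subl _ _)) // defCP.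
  by rewrite cycle_subG defx mem_quotient // mem_gen // inE cycle_id orbT.
apply: (@cyclicS _ (<[x]> / P)%G); last by rewrite quotient_cyclic ?cycle_cyclic.
have nPx : <[x]> \subset 'N(P) by rewrite cycle_subG (subsetP nPC).
by rewrite /= -(quotientYidl nPx) quotientS.
Qed.

(** If P is a normal p-subgroup of C with C contained in P<x>, then PR plays the same role for CR,
    with the same x. *)
Lemma cyclic_mod_joing p (gT : finGroupType) (R C : {group gT}) :
    prime p -> p.-group R -> C \subset 'N(R) ->
  cyclic_mod p C -> cyclic_mod p (C <*> R)%G.
Proof.
case: p => // p1 _ pR nRC [P [nsPC pP /(cyclic_quotientP nsPC)[x Cx sCPx]]].
have [sPC nPC] := andP nsPC; exists (P <*> R)%G.
have nsPR : P <*> R <| C <*> R.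
  rewrite /normal genS ?setSU //= join_subG normsY //.
  by apply: subset_trans (normG _); apply: joing_subr.
split; first exact: nsPR.
  by rewrite /= norm_joinEl ?pgroupM ?pP // (subset_trans sPC).
apply/(cyclic_quotientP nsPR); exists x; first by rewrite (subsetP (joing_subl _ _)).
rewrite join_subG (subset_trans sCPx) ?genS ?setSU ?joing_subl //.
by rewrite (subset_trans (joing_subr P R)) ?joing_subl.
Qed.

Lemma cyclic_modJ p (gT : finGroupType) (C : {group gT}) g :
  cyclic_mod p C -> cyclic_mod p (C :^ g)%G.
Proof.
case: p => [|p]; first by rewrite /cyclic_mod cyclicJ.
case=> P [nsPC pP /(cyclic_quotientP nsPC)[x Cx sCPx]]; exists (P :^ g)%G.
split; rewrite ?normalJ ?pgroupJ //; apply/cyclic_quotientP; rewrite ?normalJ //=.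
by exists (x ^ g); rewrite ?memJ_conjg // cycleJ -conjYg conjSg.
Qed.

Section VirtualSets.

Local Open Scope ring_scope.

Variables (p : nat) (gT : finGroupType).
Implicit Types (G Q K L R C : {group gT}) (e : {group gT} -> int).

(* [e K] is the number, counted with signs, of the points with stabiliser [K] in
   a virtual G-set on which Q acts trivially, so that the sum over [C \subset K]
   is the number of fixed points of [C]. *)
Definition null_weight G Q e :=
  (forall K, e K != 0 -> Q \subset K /\ K \subset G) /\
  (forall C, C \subset G -> cyclic_mod p C ->
     \sum_(K : {group gT} | C \subset K) e K = 0).

(* [#|K| * phi K], summed over the points of a G-set with stabiliser [K], is
   [#|G|] times the sum of [phi] over the orbits. *)
Definition null_sum G Q (phi : {group gT} -> int) :=
  forall e, null_weight G Q e -> \sum_(K : {group gT}) e K * (#|K|%:Z * phi K) = 0.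

Lemma eq_null_sum G Q phi psi :
    (forall K, Q \subset K -> K \subset G -> phi K = psi K) ->
  null_sum G Q phi -> null_sum G Q psi.
Proof.
move=> eq_phi null_phi e null_e; rewrite -[RHS](null_phi e null_e).
apply: eq_bigr => K _; have [-> | /(proj1 null_e)[sQK sKG]] := eqVneq (e K) 0.
  by rewrite !mul0r.
by rewrite eq_phi.
Qed.

Lemma null_sumB G Q phi psi : null_sum G Q phi -> null_sum G Q psi ->
  null_sum G Q (fun K => phi K - psi K).
Proof.
move=> null_phi null_psi e null_e.
under eq_bigr do rewrite !mulrBr.
by rewrite sumrB null_phi // null_psi // subr0.
Qed.

(** The fixed points of R form an N_G(R)-set, in which a point with stabiliser K in G has stabiliser
    N_K(R). The points of it fixed by C are those fixed by CR, and CR is again cyclic mod p. *)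
Lemma null_weight_norm G Q R e : prime p -> p.-group R -> R \subset G ->
    null_weight G Q e ->
  null_weight 'N_G(R)%G R
    (fun L => \sum_(K : {group gT} | (R \subset K) && ('N_K(R)%G == L)) e K).
Proof.
move=> p_pr pR sRG [supp_e null_e]; split=> [L | C].
    move=> nzL; have [K /andP[/andP[sRK /eqP <-] nzK]] : exists K : {group gT},
      (R \subset K) && ('N_K(R)%G == L) && (e K != 0).
    apply/existsP; apply: contraNT nzL => /existsPn noK.
    rewrite big1 // => K PK; apply/eqP; apply: contraNT (noK K) => nzK.
    by rewrite PK.
  have [_ sKG] := supp_e K nzK.
  by rewrite subsetI sRK normG setSI.
move=> sCN cycC; rewrite -[RHS](null_e (C <*> R)%G).
- rewrite (exchange_big_dep predT) //= [RHS]big_mkcond /=.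
  apply: eq_bigr => K _; rewrite join_subG.
  have [sRK | _] := boolP (R \subset K); last first.
    by rewrite andbF big1 // => L; rewrite andbF.
  rewrite andbT /=; have [sCK | nsCK] := boolP (C \subset K).
    rewrite (big_pred1 'N_K(R)%G) // => L /=.
    rewrite eq_sym; apply/andb_idl => /eqP ->.
    by rewrite subsetI sCK (subset_trans sCN) ?subsetIr.
  rewrite big_pred0 // => L; apply: contraNF nsCK => /andP[sCL /eqP defL].
  by rewrite (subset_trans sCL) // -defL subsetIl.
- by rewrite join_subG sRG andbT (subset_trans sCN) ?subsetIl.
- by apply: cyclic_mod_joing; rewrite // (subset_trans sCN) ?subsetIr.
Qed.

Lemma sum_norm_null_weight G Q R e (tau : {group gT} -> int) :
    prime p -> p.-group R -> R \subset G -> null_weight G Q e ->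
    null_sum 'N_G(R)%G R tau ->
  \sum_(K : {group gT} | R \subset K)
    e K * (#|'N_K(R)|%:Z * tau 'N_K(R)%G) = 0.
Proof.
move=> p_pr pR sRG null_e null_tau.
rewrite -[RHS](null_tau _ (null_weight_norm p_pr pR sRG null_e)).
rewrite (partition_big (fun K : {group gT} => 'N_K(R)%G) predT) //=.
apply: eq_bigr => L _; rewrite big_distrl /=.
by apply: eq_bigr => K /andP[_ /eqP <-].
Qed.

End VirtualSets.

(** * Mackey families *)

Lemma dim_img_add (F : fieldType) (V W : vectType F) (f : 'Hom(V, W))
    (A : {vspace V}) (S : {vspace W}) :
  (\dim (f @: A + S) + \dim (A :&: (f @^-1: S)) = \dim A + \dim S)%N.
Proof.
have imgE : (f @: (A :&: (f @^-1: S)) = f @: A :&: S)%VS.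
  apply/vspaceP=> w; apply/memv_imgP/memv_capP.
    case=> v /memv_capP[Av]; rewrite -memv_preim => Sv ->.
    by rewrite memv_img.
  case=> /memv_imgP[v Av ->] Sv; exists v => //.
  by rewrite memv_cap Av -memv_preim.
have capE : ((A :&: (f @^-1: S)) :&: lker f = A :&: lker f)%VS.
  apply/vspaceP=> v; rewrite !memv_cap -memv_preim memv_ker.
  by case: eqP => [-> | _]; rewrite ?andbF // mem0v !andbT.
have := dimv_sum_cap (f @: A)%VS S; have := limg_ker_dim f A.
by have := limg_ker_dim f (A :&: (f @^-1: S)); rewrite imgE capE; lia.
Qed.

(** The quotient of [f @: A + S] by S is A modulo the preimage of S, so its dimension depends only
    on which elements of A are sent into S. *)
Lemma dim_img_add_eq (F : fieldType) (V W1 W2 : vectType F)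
    (f : 'Hom(V, W1)) (g : 'Hom(V, W2)) (A : {vspace V}) (S : {vspace W1}) (T : {vspace W2}) :
    {in A, forall a, (f a \in S) = (g a \in T)} ->
  (\dim (f @: A + S) + \dim T = \dim (g @: A + T) + \dim S)%N.
Proof.
move=> eqST; have := dim_img_add f A S; have := dim_img_add g A T.
suff -> : (A :&: (f @^-1: S) = A :&: (g @^-1: T))%VS by lia.
apply/vspaceP=> v; rewrite !memv_cap -!memv_preim.
by have [Av | //] := boolP (v \in A); rewrite /= eqST.
Qed.

Section MackeyFamilies.

Local Open Scope ring_scope.

Variables (F : fieldType) (p : nat) (gT : finGroupType) (V : vectType F).
Variables (G Q : {group gT}) (r : gT -> 'End(V)).
Hypotheses (p_pr : prime p) (charF : p \in [pchar F]) (repG : is_rep G r).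
Hypotheses (nsQG : Q <| G).
Implicit Types (K L R J : {group gT}) (A B : {group gT} -> {vspace V}).

(* Subfunctors of the cohomological Mackey functor [K |-> fixv r K]. *)
Record mackey A : Prop := Mackey {
  mackey_fix : forall K, Q \subset K -> K \subset G -> (A K <= fixv r K)%VS;
  mackey_res : forall L K, Q \subset L -> L \subset K -> K \subset G ->
    (A K <= A L)%VS;
  mackey_conj : forall K g v, Q \subset K -> K \subset G -> g \in G ->
    v \in A K -> r g v \in A (K :^ g)%G;
  mackey_tr : forall L K v, Q \subset L -> L \subset K -> K \subset G ->
    v \in A L -> rtr r L K v \in A K }.

Lemma subsetQ_conj K g : Q \subset K -> g \in G -> Q \subset K :^ g.
Proof.
by move=> sQK Gg; rewrite -(normsP (normal_norm nsQG) g Gg) conjSg.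
Qed.

Lemma subset_conj K g : K \subset G -> g \in G -> K :^ g \subset G.
Proof. by move=> sKG Gg; rewrite -(conjGid Gg) conjSg. Qed.

Lemma mackey_conj_eq A K g v : mackey A -> Q \subset K -> K \subset G ->
  g \in G -> (r g v \in A (K :^ g)%G) = (v \in A K).
Proof.
move=> mA sQK sKG Gg; apply/idP/idP=> [Av | ]; last exact: (mackey_conj mA).
have eqK : ((K :^ g) :^ g^-1)%G = K by apply: val_inj; rewrite /= conjsgK.
have := mackey_conj mA (subsetQ_conj sQK Gg) (subset_conj sKG Gg) (groupVr Gg) Av.
by rewrite eqK (repK repG).
Qed.

(** Restrict v to a Sylow p-subgroup P of K and take the trace back: the result is v times the index
    of P in K, which is invertible in F. *)
Lemma mackey_p_subgroups A B :
    p.-group Q -> mackey A -> mackey B ->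
    (forall R, Q \subset R -> R \subset G -> p.-group R -> (A R <= B R)%VS) ->
  forall K, Q \subset K -> K \subset G -> (A K <= B K)%VS.
Proof.
move=> pQ mA mB sAB K sQK sKG; apply/subvP=> v Av.
have [P sylP sQP] := Sylow_superset sQK pQ.
have [sPK pP p'KP] := and3P sylP.
have Bv : v \in B P.
  apply: (subvP (sAB P sQP (subset_trans sPK sKG) pP)).
  exact: (subvP (mackey_res mA sQP sPK sKG)).
have fixv := subvP (mackey_fix mA sQK sKG) v Av.
have := mackey_tr mB sQP sPK sKG Bv; rewrite (rtr_index sPK fixv).
rewrite -scaler_nat => Bnv.
have nz : #|K : P|%:R != 0 :> F.
  by rewrite -(dvdn_pcharf charF) -p'natE.
by rewrite -[v](scalerK nz) memvZ.
Qed.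

End MackeyFamilies.

Section Filtration.

Local Open Scope ring_scope.

Variables (F : fieldType) (p : nat) (gT : finGroupType) (V : vectType F).
Variables (G Q : {group gT}) (r : gT -> 'End(V)).
Hypothesis repG : is_rep G r.
Hypotheses (nsQG : Q <| G).
Variables (i : nat) (A B : {group gT} -> {vspace V}).
Hypotheses (mA : mackey G Q r A) (mB : mackey G Q r B).
Hypothesis sBA : forall K : {group gT}, Q \subset K -> K \subset G ->
  (B K <= A K)%VS.
Hypothesis sAB : forall R : {group gT}, Q \subset R -> R \subset G ->
  p.-group R -> (#|R| <= i)%N -> (A R <= B R)%VS.
Implicit Types (K L R J : {group gT}).

(** The p-subgroups of the smallest order at which A and B are still allowed to differ. *)
Definition level R := [&& Q \subset R, R \subset G, p.-group R & #|R| == i.+1].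

(** The largest subfunctor of A that lies in B on the groups of the level. *)
Definition Ker K := (A K :&: \bigcap_(R : {group gT} | level R && (R \subset K)) B R)%VS.

(** The smallest subfunctor containing [Ker] that agrees with A on the groups of the level. Thus B,
    [Ker], [Gen], A form a chain whose middle quotient carries all that happens at the level. *)
Definition Gen K :=
  (\sum_(R : {group gT} | level R && (R \subset K)) (rtr r R K @: A R) + Ker K)%VS.

(** The dimension, modulo [B R], of the image of [A R] under the relative trace from R to L; it is
    used for L inside the normaliser of R. *)
Definition tau R L : int :=
  (\dim (rtr r R L @: A R + B R))%:Z - (\dim (B R))%:Z.

Lemma levelP R : level R -> [/\ Q \subset R, R \subset G, p.-group R & #|R| = i.+1].
Proof. by case/and4P=> ? ? ? /eqP. Qed.

Lemma level_conj R g : g \in G -> level (R :^ g)%G = level R.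
Proof.
move=> Gg; have Gv := groupVr Gg.
have sG (X : {group gT}) x : x \in G -> (X :^ x \subset G) = (X \subset G).
  by move=> Gx; rewrite -{1}(conjGid Gx) conjSg.
have sQ : (Q \subset R :^ g) = (Q \subset R).
  by rewrite -{1}(normsP (normal_norm nsQG) g Gg) conjSg.
by rewrite /level /= sQ sG // pgroupJ cardJg.
Qed.

Lemma mem_Ker K v : reflect
  (v \in A K /\ forall R, level R -> R \subset K -> v \in B R) (v \in Ker K).
Proof.
apply: (iffP memv_capP) => -[Av Bv]; split=> //.
  move=> R lR sRK; move: Bv; rewrite memvE => /subv_bigcapP/(_ R).
  by rewrite lR sRK -memvE; apply.
by rewrite memvE; apply/subv_bigcapP=> R /andP[lR sRK]; rewrite -memvE Bv.
Qed.

Lemma mem_Gen_img R K a : level R -> R \subset K -> a \in A R ->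
  rtr r R K a \in Gen K.
Proof.
move=> lR sRK Aa; rewrite -[rtr r R K a]addr0 memv_add ?mem0v //.
by rewrite (subvP (sumv_sup R _ (subvv _))) ?memv_img // lR.
Qed.

Lemma Gen_ind K (U : {vspace V}) :
    (forall R a, level R -> R \subset K -> a \in A R -> rtr r R K a \in U) ->
    (Ker K <= U)%VS ->
  (Gen K <= U)%VS.
Proof.
move=> trU sKU; rewrite subv_add sKU andbT; apply/subv_sumP=> R /andP[lR sRK].
by apply/subvP=> _ /memv_imgP[a Aa ->]; apply: trU.
Qed.

(** A term of Mackey's formula that passes through a p-group of order at most i lies in B, since A
    and B agree on that group and B is stable under traces. The next two lemmas are the cases in
    which the intersection is proper in a group of the level. *)
Lemma small_tr L J g v :
    Q \subset L -> L \subset G -> Q \subset J -> J \subset G -> g \in G ->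
    p.-group (L :^ g :&: J) -> (#|L :^ g :&: J| <= i)%N -> v \in A L ->
  rtr r (L :^ g :&: J) J (r g v) \in B J.
Proof.
move=> sQL sLG sQJ sJG Gg pD leD Av.
have sQLg := subsetQ_conj nsQG sQL Gg; have sLgG := subset_conj sLG Gg.
have sQD : Q \subset L :^ g :&: J by rewrite subsetI sQLg.
apply: (@mackey_tr _ _ _ _ _ _ _ mB (L :^ g :&: J)%G J) => //.
  exact: subsetIr.
apply: (subvP (sAB _ _ _ _)) => //; first by rewrite subIset ?sLgG.
apply: (subvP (@mackey_res _ _ _ _ _ _ _ mA _ (L :^ g)%G _ _ _)) => //.
  exact: subsetIl.
exact: (mackey_conj mA).
Qed.

Lemma level_tr_lt R L g v : level R -> Q \subset L -> L \subset G -> g \in G ->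
  ~~ (R \subset L :^ g) -> v \in A L -> rtr r (L :^ g :&: R) R (r g v) \in B R.
Proof.
case/levelP=> sQR sRG pR oR sQL sLG Gg nsRL Av; apply: small_tr => //.
  by rewrite (pgroupS _ pR) ?subsetIr.
by rewrite -ltnS -oR proper_card // properE subsetIr subsetI subxx andbT.
Qed.

Lemma tr_level_lt R L g v : level R -> Q \subset L -> L \subset G -> g \in G ->
  ~~ (R :^ g \subset L) -> v \in A R -> rtr r (R :^ g :&: L) L (r g v) \in B L.
Proof.
case/levelP=> sQR sRG pR oR sQL sLG Gg nsRL Av.
apply: small_tr => //; first by rewrite (pgroupS (subsetIl _ _)) //= pgroupJ.
by rewrite -ltnS -oR -(cardJg R g) proper_card // properE subsetIl subsetI subxx.
Qed.

Lemma mackey_Ker : mackey G Q r Ker.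
Proof.
split=> [K sQK sKG | L K sQL sLK sKG | K g v sQK sKG Gg | L K v sQL sLK sKG].
- exact: subv_trans (capvSl _ _) (mackey_fix mA sQK sKG).
- apply/subvP=> v /mem_Ker[Av Bv]; apply/mem_Ker; split.
    exact: (subvP (mackey_res mA sQL sLK sKG)).
  by move=> R lR sRL; apply: Bv => //; apply: subset_trans sLK.
- case/mem_Ker=> Av Bv; apply/mem_Ker; split; first exact: (mackey_conj mA).
  move=> R lR sRKg; have [sQR sRG _ _] := levelP lR; have Gv := groupVr Gg.
  rewrite -(mackey_conj_eq repG nsQG _ mB sQR sRG Gv) (repK repG) //.
  by apply: Bv; rewrite ?level_conj //= sub_conjgV.
- have sLG := subset_trans sLK sKG; case/mem_Ker=> Av Bv; apply/mem_Ker; split.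
    exact: (mackey_tr mA).
  move=> R lR sRK; have [sQR sRG _ _] := levelP lR.
  have fixv := subvP (mackey_fix mA sQL sLG) v Av.
  (* In Mackey's formula the terms with R inside [L :^ g] are traces from R to itself of conjugates
     of v, which restrict into [B R]; all others pass through proper subgroups of R. *)
  apply: (rtr_sub repG sLK sRK sKG fixv) => g Kg; have Gg := subsetP sKG g Kg.
  have [sRLg | nsRLg] := boolP (R \subset L :^ g); last exact: level_tr_lt.
  rewrite (setIidPr sRLg).
  have Br : r g v \in B R.
    rewrite -(mackey_conj_eq repG nsQG _ mB sQR sRG (groupVr Gg)) (repK repG) //.
    by apply: Bv; rewrite ?level_conj ?groupV //= sub_conjgV.
  have := rtr_index (subxx R) (subvP (mackey_fix mB sQR sRG) _ Br).
  by rewrite indexgg mulr1n => ->.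
Qed.

Lemma sub_B_Ker K : Q \subset K -> K \subset G -> (B K <= Ker K)%VS.
Proof.
move=> sQK sKG; apply/subvP=> v Bv; apply/mem_Ker; split.
  exact: (subvP (sBA sQK sKG)).
move=> R /levelP[sQR sRG _ _] sRK; exact: (subvP (mackey_res mB sQR sRK sKG)).
Qed.

Lemma sub_Gen_A K : Q \subset K -> K \subset G -> (Gen K <= A K)%VS.
Proof.
move=> sQK sKG; apply: Gen_ind; last exact: capvSl.
by move=> R a /levelP[sQR _ _ _] sRK Aa; apply: (mackey_tr mA).
Qed.

Lemma mackey_Gen : mackey G Q r Gen.
Proof.
have mK := mackey_Ker.
split=> [K sQK sKG | L K sQL sLK sKG | K g v sQK sKG Gg | L K v sQL sLK sKG].
- exact: subv_trans (sub_Gen_A sQK sKG) (mackey_fix mA sQK sKG).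
- have sLG := subset_trans sLK sKG; apply: Gen_ind; last first.
    exact: subv_trans (mackey_res mK sQL sLK sKG) (addvSr _ _).
  move=> R a lR sRK Aa; have [sQR sRG _ _] := levelP lR.
  have fixa := subvP (mackey_fix mA sQR sRG) a Aa.
  (* By Mackey's formula the restriction to L is a sum of traces from the conjugates of R contained
     in L, which are generators, and of terms already in [B L]. *)
  apply: (rtr_sub repG sRK sLK sKG fixa) => g Kg; have Gg := subsetP sKG g Kg.
  have [sRgL | nsRgL] := boolP (R :^ g \subset L).
    rewrite (setIidPl sRgL); apply: (@mem_Gen_img (R :^ g)%G L) => //.
      by rewrite level_conj.
    exact: (mackey_conj mA).
  apply: (subvP (subv_trans (sub_B_Ker sQL sLG) (addvSr _ _))).
  exact: tr_level_lt.
- suff: (Gen K <= (r g @^-1: Gen (K :^ g)%G))%VS.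
    by move/subvP/[apply]; rewrite -memv_preim.
  apply: Gen_ind => [R a lR sRK Aa | ]; last first.
    apply/subvP=> w Kw; rewrite -memv_preim.
    by apply: (subvP (addvSr _ _)); apply: (mackey_conj mK).
  have [sQR sRG _ _] := levelP lR.
  rewrite -memv_preim (rtr_conj repG sRK sKG Gg); last first.
    exact: (subvP (mackey_fix mA sQR sRG)).
  apply: (@mem_Gen_img (R :^ g)%G (K :^ g)%G); rewrite ?level_conj ?conjSg //.
  exact: (mackey_conj mA).
- suff: (Gen L <= (rtr r L K @^-1: Gen K))%VS.
    by move/subvP/[apply]; rewrite -memv_preim.
  apply: Gen_ind => [R a lR sRL Aa | ]; last first.
    apply/subvP=> w Kw; rewrite -memv_preim.
    by apply: (subvP (addvSr _ _)); apply: (mackey_tr mK).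
  have [sQR sRG _ _] := levelP lR.
  rewrite -memv_preim (rtr_tower repG sRL sLK sKG); last first.
    exact: (subvP (mackey_fix mA sQR sRG)).
  by apply: mem_Gen_img; rewrite // (subset_trans sRL).
Qed.

Lemma tr_level_diff R S K a : level R -> level S -> R \subset K -> S \subset K ->
    K \subset G -> {in K, forall g, R :^ g != S} -> a \in A R ->
  rtr r R K a \in B S.
Proof.
move=> lR lS sRK sSK sKG neqRS Aa; have [sQR sRG _ oR] := levelP lR.
have [_ _ _ oS] := levelP lS.
have fixa := subvP (mackey_fix mA sQR sRG) a Aa.
apply: (rtr_sub repG sRK sSK sKG fixa) => g Kg.
apply: level_tr_lt => //; first exact: (subsetP sKG).
apply: contra (neqRS g Kg) => sSRg.
by rewrite eq_sym eqEcard sSRg cardJg oR oS leqnn.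
Qed.

(* Only the fixed points of R on the cosets of R in K contribute modulo [B R]. *)
Lemma tr_level_norm R K a : level R -> R \subset K -> K \subset G -> a \in A R ->
  rtr r R K a - rtr r R 'N_K(R) a \in B R.
Proof.
move=> lR sRK sKG Aa; have [sQR sRG _ oR] := levelP lR.
have fixa := subvP (mackey_fix mA sQR sRG) a Aa.
have sRN : R \subset 'N_K(R) by rewrite subsetI sRK normG.
have sNK : 'N_K(R) \subset K := subsetIl _ _.
have capN : rcosets R K :&: rcosets R 'N_K(R) = rcosets R 'N_K(R).
  exact/setIidPr/imsetS.
have -> : rtr r R K a = rtr r R 'N_K(R) a +
    \sum_(C in rcosets R K :\: rcosets R 'N_K(R)) r (repr C) a.
  rewrite (rtrE r R K) (rtrE r R 'N_K(R)%G) /=.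
  by rewrite (big_setID (rcosets R 'N_K(R))) /= capN.
rewrite addrC addKr.
apply: (rcosets_sum_sub repG sRK sRK sKG fixa); first exact: subsetDl.
  apply: actsD; last first.
    exact: subset_trans sRN (actsRs_rcosets _ _).
  exact: subset_trans sRK (actsRs_rcosets _ _).
move=> g Kg; rewrite inE => /andP[notN _]; apply: level_tr_lt => //.
  exact: (subsetP sKG).
apply: contra notN => sRRg; apply/rcosetsP; exists g => //.
by rewrite inE Kg; apply/normP/eqP; rewrite eq_sym eqEcard sRRg cardJg leqnn.
Qed.

(** Restrict the trace to a group S of the level. If S is not conjugate to R in K the result is in
    [B S]; if it is, the K-invariance of the trace reduces to S = R, where only the trace to the
    normaliser matters modulo [B R]. *)
Lemma mem_Ker_tr R K a : level R -> R \subset K -> K \subset G -> a \in A R ->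
  (rtr r R K a \in Ker K) = (rtr r R 'N_K(R)%G a \in B R).
Proof.
move=> lR sRK sKG Aa; have [sQR sRG _ oR] := levelP lR.
have sQK := subset_trans sQR sRK.
have fixa := subvP (mackey_fix mA sQR sRG) a Aa.
have BE : (rtr r R K a \in B R) = (rtr r R 'N_K(R)%G a \in B R).
  have Bd := tr_level_norm lR sRK sKG Aa.
  by rewrite -[in LHS](subrK (rtr r R 'N_K(R)%G a) (rtr r R K a)) rpredDl.
rewrite -BE; apply/idP/idP=> [/mem_Ker[_]|Ba]; first exact.
apply/mem_Ker; split=> [|S lS sSK]; first exact: (mackey_tr mA).
have [[g Kg defS] | noconj] := altP (@exists_inP _ (mem K) (fun g => R :^ g == S)).
  have -> : S = (R :^ g)%G by apply/val_inj/esym/eqP.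
  have /fixvP/(_ g Kg) <- := rtr_fixv repG sRK sKG fixa.
  exact: (mackey_conj mB sQR sRG (subsetP sKG g Kg)).
apply: (@tr_level_diff R) => // g Kg.
by apply: contra noconj => defS; apply/exists_inP; exists g.
Qed.

Lemma dim_tr_Ker R K : level R -> R \subset K -> K \subset G ->
  (\dim (rtr r R K @: A R + Ker K))%:Z - (\dim (Ker K))%:Z = tau R 'N_K(R)%G.
Proof.
move=> lR sRK sKG.
have := @dim_img_add_eq _ _ _ _ (rtr r R K) (rtr r R 'N_K(R)%G) (A R) (Ker K) (B R).
by move/(_ (fun a => mem_Ker_tr lR sRK sKG)); rewrite /tau; lia.
Qed.

Lemma tr_level_conj R K g : level R -> R \subset K -> K \subset G -> g \in K ->
  (rtr r (R :^ g) K @: A (R :^ g)%G = rtr r R K @: A R)%VS.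
Proof.
move=> lR sRK sKG Kg; have [sQR sRG _ _] := levelP lR.
have Gg := subsetP sKG g Kg.
have trE a : a \in A R -> rtr r (R :^ g) K (r g a) = rtr r R K a.
  move=> Aa; have fixa := subvP (mackey_fix mA sQR sRG) a Aa.
  have /fixvP/(_ g Kg) <- := rtr_fixv repG sRK sKG fixa.
  by rewrite (rtr_conj repG sRK sKG Gg fixa) (conjGid Kg).
apply/vspaceP=> w; apply/memv_imgP/memv_imgP=> -[a Aa ->].
  have Ag : r g^-1%g a \in A R.
    by rewrite -(mackey_conj_eq repG nsQG _ mA sQR sRG Gg) (repKV repG).
  by exists (r g^-1%g a); rewrite // -(trE _ Ag) (repKV repG).
exists (r g a); last by rewrite trE.
exact: (mackey_conj mA).
Qed.

(** Modulo [Ker K] the images of the traces are equal within a K-conjugacy class and independent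
    between classes. The class of R has as many members as the index of N_K(R) in K, so the weights
    [#|'N_K(R)|] add up to [#|K|] once per class. The induction removes one class O at a time. *)
Lemma dim_levels K (S : {set {group gT}}) : K \subset G ->
    {in S, forall R, level R && (R \subset K)} ->
    {in S & K, forall R g, (R :^ g)%G \in S} ->
  #|K|%:Z * ((\dim (\sum_(R in S) (rtr r R K @: A R) + Ker K))%:Z
             - (\dim (Ker K))%:Z)
  = \sum_(R in S) #|'N_K(R)|%:Z * tau R 'N_K(R)%G.
Proof.
move=> sKG; have [n leSn] := ubnP #|S|; elim: n S leSn => // n IHn S leSn lS conjS.
have [-> | [R SR]] := set_0Vmem S.
  by rewrite !big_set0 add0v subrr mulr0.
have /andP[lR sRK] := lS R SR; pose O := orbit 'JG K R.
have sOS : O \subset S by apply/subsetP=> _ /imsetP[g Kg ->]; apply: conjS.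
have OR : R \in O by apply: orbit_refl.
have lO (T : {group gT}) : T \in O -> exists2 g, g \in K & T = (R :^ g)%G.
  by case/imsetP=> g Kg ->; exists g.
pose D := S :\: O; have{IHn} := IHn D.
rewrite (leq_trans _ (ltnSE leSn)); last first.
  by rewrite [leqRHS](cardsD1 R) SR ltnS subset_leq_card // setDS // sub1set.
have lD : {in D, forall T, level T && (T \subset K)}.
  by move=> T /setDP[/lS].
have conjD : {in D & K, forall T g, (T :^ g)%G \in D}.
  move=> T g /setDP[ST notOT] Kg; rewrite inE conjS // andbT.
  by apply: contra notOT; rewrite (orbit_actr 'JG).
move=> /(_ isT lD conjD); set U := (\sum_(T in D) _ + Ker K)%VS => dimU.
set W := (rtr r R K @: A R)%VS.
have WO : (\sum_(T in O) (rtr r T K @: A T) = W)%VS.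
  apply/eqP; rewrite eqEsubv; apply/andP; split.
    apply/subv_sumP=> T /lO[g Kg ->].
    by rewrite (tr_level_conj lR sRK sKG Kg) subvv.
  exact: (sumv_sup R).
(* Independence of the classes: U, spanned by the other classes and [Ker K], lies in [B R], and a
   trace from R that lies in [B R] is in [Ker K]. *)
have WU : ((W + Ker K) :&: U = Ker K)%VS.
  apply/eqP; rewrite eqEsubv subv_cap !addvSr !andbT.
  apply/subvP=> w /memv_capP[/memv_addP[_ /memv_imgP[a Aa ->] [b Kb ->]] Uw].
  rewrite memvD // (mem_Ker_tr lR sRK sKG Aa).
  have BE := tr_level_norm lR sRK sKG Aa.
  have Bb : b \in B R by have /mem_Ker[_] := Kb; apply.
  have sUB : (U <= B R)%VS.
    rewrite subv_add; apply/andP; split; last first.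
      by apply/subvP=> v /mem_Ker[_]; apply.
    apply/subv_sumP=> T /setDP[ST notOT]; apply/subvP=> _ /memv_imgP[c Ac ->].
    have /andP[lT sTK] := lS T ST; apply: (@tr_level_diff T) => // g Kg.
    apply: contra notOT => /eqP eqR; apply/orbitP; exists g^-1%g.
      by rewrite groupV.
    by apply: val_inj; rewrite /= -eqR conjsgK.
  have := subvP sUB _ Uw; rewrite rpredDr //.
  by rewrite -[rtr r R K a](subrK (rtr r R 'N_K(R)%G a)) rpredDl.
have -> : (\sum_(T in S) (rtr r T K @: A T) + Ker K = (W + Ker K) + U)%VS.
  rewrite (big_setID O) /= (setIidPr sOS) -/D WO.
  by rewrite /U -!addvA; congr (_ + _)%VS; rewrite [RHS]addvC -addvA addvv.
rewrite (big_setID O) /= (setIidPr sOS) -/D -dimU.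
have -> : \sum_(T in O) #|'N_K(T)|%:Z * tau T 'N_K(T)%G =
    #|K|%:Z * tau R 'N_K(R)%G.
  rewrite (eq_bigr (fun=> #|'N_K(R)|%:Z * tau R 'N_K(R)%G)); last first.
    move=> T /lO[g Kg ->]; have Gg := subsetP sKG g Kg.
    rewrite -(dim_tr_Ker lR sRK sKG) -(tr_level_conj lR sRK sKG Kg).
    rewrite (@dim_tr_Ker (R :^ g)%G) ?level_conj //; last first.
      by rewrite -(conjGid Kg) conjSg.
    by rewrite normJ -{1}(conjGid Kg) -conjIg cardJg.
  rewrite sumr_const -mulr_natl mulrA; congr (_ * _).
  rewrite natz -PoszM -(card_orbit_in_stab 'JG R (subsetT K)) astab1JG.
  by [].
have := dimv_sum_cap (W + Ker K)%VS U; rewrite WU.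
have := dim_tr_Ker lR sRK sKG; rewrite -/W => <- dimE.
rewrite -mulrDr; congr (_ * _); lia.
Qed.

Lemma dim_Gen K : K \subset G ->
  #|K|%:Z * ((\dim (Gen K))%:Z - (\dim (Ker K))%:Z)
  = \sum_(R : {group gT} | level R && (R \subset K)) #|'N_K(R)|%:Z * tau R 'N_K(R)%G.
Proof.
move=> sKG.
have := @dim_levels K [set R : {group gT} | level R && (R \subset K)] sKG.
rewrite (eq_bigl (fun R : {group gT} => level R && (R \subset K))); last first.
  by move=> R; rewrite inE.
rewrite [RHS](eq_bigl (fun R : {group gT} => level R && (R \subset K))); last first.
  by move=> R; rewrite inE.
apply=> [R | R g]; rewrite !inE // => /andP[lR sRK] Kg.
by rewrite level_conj ?(subsetP sKG) // lR -(conjGid Kg) conjSg.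
Qed.

End Filtration.

Section MackeyDifference.

Local Open Scope ring_scope.

Variables (F : fieldType) (p : nat) (gT : finGroupType) (V : vectType F).
Variables (G Q : {group gT}) (r : gT -> 'End(V)) (e : {group gT} -> int).
Hypotheses (p_pr : prime p) (charF : p \in [pchar F]) (repG : is_rep G r).
Hypotheses (nsQG : Q <| G) (pQ : p.-group Q) (null_e : null_weight p G Q e).
Implicit Types (K L R J : {group gT}) (A B : {group gT} -> {vspace V}).

(** The form in which the induction hypothesis for larger p-subgroups enters; [null_tr_index]
    supplies it. *)
Hypothesis null_tau : forall R (S T : {vspace V}),
    Q \subset R -> R \subset G -> p.-group R -> (#|Q| < #|R|)%N ->
    (S <= fixv r R)%VS -> {in 'N_G(R), forall g v, v \in S -> r g v \in S} ->
    {in 'N_G(R), forall g v, v \in T -> r g v \in T} ->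
  null_sum p 'N_G(R)%G R
    (fun L => (\dim (rtr r R L @: S + T))%:Z - (\dim T)%:Z).

Lemma mackey_norm A R g v : mackey G Q r A -> Q \subset R -> R \subset G ->
  g \in 'N_G(R) -> v \in A R -> r g v \in A R.
Proof.
move=> mA sQR sRG /setIP[Gg Ng] Av.
have <- : (R :^ g)%G = R by apply: val_inj; apply: (normP Ng).
exact: (mackey_conj mA).
Qed.

(** Induction on [#|G| - i] along the chain B, [Ker], [Gen], A. The two outer quotients vanish up to
    order i + 1, and the middle one is computed by [dim_Gen]. Once i reaches [#|G|], A and B agree
    on all p-subgroups containing Q, hence everywhere. *)
Lemma null_mackey_levels i A B : (#|Q| <= i)%N ->
    mackey G Q r A -> mackey G Q r B ->
    (forall K, Q \subset K -> K \subset G -> (B K <= A K)%VS) ->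
    (forall R, Q \subset R -> R \subset G -> p.-group R -> (#|R| <= i)%N ->
      (A R <= B R)%VS) ->
  \sum_(K : {group gT}) e K * (#|K|%:Z * ((\dim (A K))%:Z - (\dim (B K))%:Z)) = 0.
Proof.
have [n len] := ubnP (#|G| - i); elim: n i len A B => // n IHn i len A B.
move=> leQi mA mB sBA sAB; have [leGi | ltiG] := leqP #|G| i.
  apply: big1 => K _; have [-> | /(proj1 null_e)[sQK sKG]] := eqVneq (e K) 0.
    by rewrite mul0r.
  suff -> : A K = B K by rewrite subrr !mulr0.
  apply/eqP; rewrite eqEsubv sBA // andbT.
  apply: (mackey_p_subgroups p_pr charF pQ mA mB) => // R sQR sRG pR.
  by apply: sAB => //; apply: leq_trans (subset_leq_card sRG) leGi.
have mK := mackey_Ker repG nsQG mA mB sAB.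
have mG := mackey_Gen repG nsQG mA mB sBA sAB.
have ltn : (#|G| - i.+1 < n)%N by lia.
have leQi1 : (#|Q| <= i.+1)%N by lia.
pose Ki := Ker p G Q i A B; pose Gi := Gen p G Q r i A B.
have sum1 : \sum_(K : {group gT})
    e K * (#|K|%:Z * ((\dim (A K))%:Z - (\dim (Gi K))%:Z)) = 0.
  apply: (IHn i.+1) => // [K sQK sKG | R sQR sRG pR leRi].
    exact: sub_Gen_A.
  have [leR | ltR] := leqP #|R| i.
    apply: subv_trans (sAB R sQR sRG pR leR) _.
    have sBK : (B R <= Ki R)%VS by apply: (sub_B_Ker _ _ mB sBA).
    exact: subv_trans sBK (addvSr _ _).
  have lR : level p G Q i R by rewrite /level sQR sRG pR /= eqn_leq leRi.
  apply/subvP=> v Av; have fixv := subvP (mackey_fix mA sQR sRG) v Av.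
  have := rtr_index (subxx R) fixv; rewrite indexgg mulr1n => <-.
  exact: mem_Gen_img.
have sum3 : \sum_(K : {group gT})
    e K * (#|K|%:Z * ((\dim (Ki K))%:Z - (\dim (B K))%:Z)) = 0.
  apply: (IHn i.+1) => // [K sQK sKG | R sQR sRG pR leRi].
    exact: (sub_B_Ker _ _ mB sBA).
  have [leR | ltR] := leqP #|R| i.
    exact: subv_trans (capvSl _ _) (sAB R sQR sRG pR leR).
  have lR : level p G Q i R by rewrite /level sQR sRG pR /= eqn_leq leRi.
  by apply/subvP=> v /mem_Ker[_]; apply.
(* After exchanging the sums, the groups K containing a fixed R of the level contribute a sum over
   the N_G(R)-set of fixed points of R, to which [null_tau] applies. *)
have sum2 : \sum_(K : {group gT})
    e K * (#|K|%:Z * ((\dim (Gi K))%:Z - (\dim (Ki K))%:Z)) = 0.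
  transitivity (\sum_(K : {group gT}) \sum_(R : {group gT} | level p G Q i R && (R \subset K))
      e K * (#|'N_K(R)|%:Z * tau r A B R 'N_K(R)%G)).
    apply: eq_bigr => K _.
    have [-> | /(proj1 null_e)[sQK sKG]] := eqVneq (e K) 0.
      by rewrite mul0r big1 // => R _; rewrite mul0r.
    by rewrite (dim_Gen repG nsQG mA mB sAB sKG) mulr_sumr.
  rewrite (exchange_big_dep (level p G Q i)) /=; last first.
    by move=> K R _ /andP[].
  apply: big1 => R lR; have [sQR sRG pR oR] := levelP lR.
  rewrite (eq_bigl (fun K => R \subset K)) => [|K]; last by rewrite lR.
  apply: sum_norm_null_weight null_e _ => //.
  apply: null_tau => //; first by rewrite oR ltnS.
  - exact: (mackey_fix mA).
  - by move=> g Ng v; apply: mackey_norm.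
  - by move=> g Ng v; apply: mackey_norm.
rewrite (eq_bigr (fun K : {group gT} =>
  e K * (#|K|%:Z * ((\dim (A K))%:Z - (\dim (Gi K))%:Z)) +
  e K * (#|K|%:Z * ((\dim (Gi K))%:Z - (\dim (Ki K))%:Z)) +
  e K * (#|K|%:Z * ((\dim (Ki K))%:Z - (\dim (B K))%:Z)))) => [|K _]; last by ring.
by rewrite !big_split /= sum1 sum2 sum3.
Qed.

Lemma null_mackey_diff A B :
    mackey G Q r A -> mackey G Q r B ->
    (forall K, Q \subset K -> K \subset G -> (B K <= A K)%VS) ->
    (A Q <= B Q)%VS ->
  \sum_(K : {group gT}) e K * (#|K|%:Z * ((\dim (A K))%:Z - (\dim (B K))%:Z)) = 0.
Proof.
move=> mA mB sBA sAB; apply: (@null_mackey_levels #|Q|) => // R sQR sRG pR leR.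
have -> // : R = Q.
by apply/val_inj/eqP; rewrite eq_sym eqEcard sQR leR.
Qed.

End MackeyDifference.

(** * Induced modules *)

Section InducedModules.

Local Open Scope ring_scope.

Variables (F : fieldType) (p : nat) (gT : finGroupType).
Implicit Types (G Q K L R : {group gT}).

(** The vanishing of f(V) for all V with trivial action of Q: the statement that is proved by
    induction in [null_modules_p]. *)
Definition null_modules G Q := forall (V : vectType F) (r : gT -> 'End(V)),
  is_rep G r -> {in Q, forall g v, r g v = v} ->
  null_sum p G Q (fun K => (\dim (fixv r K))%:Z).

Section Submodule.

Variables (V : vectType F) (G : {group gT}) (r : gT -> 'End(V)) (S : {vspace V}).
Hypotheses (repG : is_rep G r) (stabS : {in G, forall g v, v \in S -> r g v \in S}).

Definition sub_rep g : 'End(subvs_of S) :=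
  (linfun (vsproj S) \o r g \o linfun vsval)%VF.

Lemma sub_repE g u : g \in G -> vsval (sub_rep g u) = r g (vsval u).
Proof.
move=> Gg; rewrite /sub_rep !comp_lfunE !lfunE /= vsprojK //.
by apply: stabS; rewrite ?subvsP.
Qed.

Lemma is_rep_sub : is_rep G sub_rep.
Proof.
split=> [|g h Gg Gh]; apply/lfunP=> u; apply: subvs_inj.
  by rewrite sub_repE // (rep1 repG) id_lfunE.
by rewrite comp_lfunE !sub_repE ?groupM // (repM repG).
Qed.

Lemma dim_fixv_sub K : K \subset G -> \dim (fixv sub_rep K) = \dim (S :&: fixv r K).
Proof.
move=> sKG; have sub_repK g u : g \in K -> vsval (sub_rep g u) = r g (vsval u).
  by move=> Kg; rewrite sub_repE // (subsetP sKG).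
have <- : (linfun vsval @: fixv sub_rep K = S :&: fixv r K)%VS.
  apply/vspaceP=> v; apply/memv_imgP/memv_capP=> [[u /fixvP fixu ->] | [Sv /fixvP fixv]].
    rewrite lfunE /= subvsP; split=> //; apply/fixvP=> g Kg.
    by rewrite -sub_repK // fixu.
  exists (vsproj S v); last by rewrite lfunE /= vsprojK.
  by apply/fixvP=> g Kg; apply: subvs_inj; rewrite /= sub_repK // vsprojK ?fixv.
apply/esym/limg_dim_eq/eqP; rewrite -subv0; apply/subvP=> u /memv_capP[_].
by rewrite memv_ker lfunE /= memv0 => /eqP u0; apply/eqP/subvs_inj.
Qed.

End Submodule.

Lemma null_submodule G Q (V : vectType F) (r : gT -> 'End(V)) (S : {vspace V}) :
    null_modules G Q -> Q \subset G -> is_rep G r ->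
    {in G, forall g v, v \in S -> r g v \in S} ->
    {in Q, forall g v, v \in S -> r g v = v} ->
  null_sum p G Q (fun K => (\dim (S :&: fixv r K))%:Z).
Proof.
move=> nullG sQG repG stabS trivQ.
apply: (eq_null_sum _ (nullG _ _ (is_rep_sub repG stabS) _)) => [K _ sKG | g Qg u].
  by rewrite (dim_fixv_sub stabS sKG).
apply: subvs_inj; rewrite /= (sub_repE stabS) ?(subsetP sQG) //.
by rewrite trivQ ?subvsP.
Qed.

(* The module induced from R to G by the trivial R-module S, as the space of
   functions from the cosets of R in G to S. *)
Section Induced.

Variables (V : vectType F) (G R : {group gT}) (r : gT -> 'End(V)).
Variables (S T : {vspace V}).
Hypotheses (nsRG : R <| G) (repG : is_rep G r) (fixS : (S <= fixv r R)%VS).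
Hypothesis stabS : {in G, forall g v, v \in S -> r g v \in S}.
Hypothesis stabT : {in G, forall g v, v \in T -> r g v \in T}.

Notation U := {ffun {set gT} -> V}.

(** The action only translates cosets, since R acts trivially on the values. The functions are
    defined on all sets; [ind_space] imposes the support and the values in S. *)
Definition ind_fun g (u : U) : U := [ffun C => u (C :* g^-1)].

Fact ind_fun_linear g : linear (ind_fun g).
Proof. by move=> a u v; apply/ffunP=> C; rewrite !ffunE. Qed.
HB.instance Definition _ g :=
  GRing.isLinear.Build F U U *:%R (ind_fun g) (ind_fun_linear g).

Definition ind_rep g : 'End(U) := linfun (ind_fun g).

Lemma ind_repE g (u : U) C : ind_rep g u C = u (C :* g^-1).
Proof. by rewrite lfunE /= ffunE. Qed.

Lemma is_rep_ind : is_rep G ind_rep.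
Proof.
split=> [|g h _ _]; apply/lfunP=> u; apply/ffunP=> C.
  by rewrite ind_repE id_lfunE invg1 rcoset1.
by rewrite comp_lfunE !ind_repE invMg rcosetM.
Qed.

Definition ev_fun C (u : U) : V := u C.

Fact ev_fun_linear C : linear (ev_fun C).
Proof. by move=> a u v; rewrite /ev_fun !ffunE. Qed.
HB.instance Definition _ C :=
  GRing.isLinear.Build F U V *:%R (ev_fun C) (ev_fun_linear C).

Definition ind_space : {vspace U} :=
  (\bigcap_C (linfun (ev_fun C) @^-1: (if C \in rcosets R G then S else 0)))%VS.

Definition ind_sum : 'Hom(U, V) :=
  \sum_(C in rcosets R G) (r (repr C) \o linfun (ev_fun C))%VF.

Lemma ind_sumE (u : U) : ind_sum u = \sum_(C in rcosets R G) r (repr C) (u C).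
Proof. by rewrite sum_lfunE; apply: eq_bigr => C _; rewrite comp_lfunE lfunE. Qed.

Lemma ind_spaceP (u : U) : reflect
  ((forall C, u C \in S) /\ (forall C, C \notin rcosets R G -> u C = 0))
  (u \in ind_space).
Proof.
rewrite memvE; apply: (iffP subv_bigcapP) => [indu | [Su u0] C _]; last first.
  rewrite -memvE -memv_preim lfunE /= /ev_fun.
  by case: ifPn => [_ | /u0 ->]; rewrite ?mem0v.
have {}indu C : u C \in (if C \in rcosets R G then S else 0)%VS.
  by have := indu C isT; rewrite -memvE -memv_preim lfunE.
split=> C; first by have := indu C; case: ifP => // _; rewrite memv0 => /eqP->; rewrite mem0v.
by move=> /negPf nC; have := indu C; rewrite nC memv0 => /eqP.
Qed.

Lemma mem_rcosets_translate C g : g \in G ->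
  (C :* g \in rcosets R G) = (C \in rcosets R G).
Proof.
move=> Gg; apply/rcosetsP/rcosetsP=> -[x Gx].
  move=> defC; exists (x * g^-1)%g; first by rewrite groupM ?groupV.
  by rewrite rcosetM -defC -rcosetM mulgV rcoset1.
by move=> ->; exists (x * g)%g; rewrite ?groupM // rcosetM.
Qed.

Lemma ind_space_stable : {in G, forall g (u : U), u \in ind_space -> ind_rep g u \in ind_space}.
Proof.
move=> g Gg u /ind_spaceP[Su u0]; apply/ind_spaceP; split=> C.
  by rewrite ind_repE.
move=> nC; rewrite ind_repE u0 //.
by rewrite mem_rcosets_translate ?groupV.
Qed.

Lemma ind_space_triv : {in R, forall g (u : U), u \in ind_space -> ind_rep g u = u}.
Proof.
move=> g Rg u /ind_spaceP[Su u0]; apply/ffunP=> C; rewrite ind_repE.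
have Gg : g \in G := subsetP (normal_sub nsRG) g Rg.
have [/rcosetsP[x Gx ->] | nC] := boolP (C \in rcosets R G); last first.
  by rewrite !u0 // mem_rcosets_translate ?groupV.
have xR : x \in 'N(R) := subsetP (normal_norm nsRG) x Gx.
congr (u _); rewrite -rcosetM; apply: rcoset_eqP; rewrite mem_rcoset.
have -> : (x * g^-1 * x^-1 = g^-1 ^ x^-1)%g by rewrite conjgE invgK mulgA.
by rewrite memJ_norm ?groupV.
Qed.

Lemma ind_sum_equiv g (u : U) : g \in G -> u \in ind_space ->
  ind_sum (ind_rep g u) = r g (ind_sum u).
Proof.
move=> Gg /ind_spaceP[Su _]; have sRG := normal_sub nsRG.
rewrite !ind_sumE linear_sum /= (reindex_inj (can_inj (rcosetK g))) /=.
apply: eq_big => [C | C]; first by rewrite mem_rcosets_translate.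
rewrite mem_rcosets_translate // ind_repE rcosetK => /(repr_rcosets sRG)[Gc defC].
have fixu := subvP fixS _ (Su C).
rewrite -{1}defC -rcosetM.
rewrite (rcoset_inv_repr (fixv_left_inv repG sRG (subxx G) fixu)) ?groupM //.
by rewrite (repM repG).
Qed.

(** A function fixed by L is constant on the L-orbits of cosets, and the orbit of Rx contributes a
    trace from R to L because x normalises R. Conversely the trace of a is the image of the function
    equal to a on the cosets contained in L. *)
Lemma ind_sum_fixv L : R \subset L -> L \subset G ->
  (ind_sum @: (ind_space :&: fixv ind_rep L) = rtr r R L @: S)%VS.
Proof.
move=> sRL sLG; have sRG := normal_sub nsRG.
have actsL : [acts L, on rcosets R G | 'Rs].
  exact: subset_trans sLG (actsRs_rcosets _ _).
apply/eqP; rewrite eqEsubv; apply/andP; split; apply/subvP=> w /memv_imgP[].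
  move=> u /memv_capP[/ind_spaceP[Su _] /fixvP fixu] ->.
  rewrite ind_sumE (set_partition_big _ (orbit_partition actsL)) /=.
  apply: memv_suml => _ /imsetP[_ /rcosetsP[x Gx ->] ->].
  have fixux := subvP fixS _ (Su (R :* x)).
  rewrite (eq_bigr (fun C => r (repr C) (u (R :* x)))) => [|_ /imsetP[l Ll ->]]; last first.
    rewrite /= rcosetE; congr (r _ _); have := fixu l^-1%g; rewrite groupV => /(_ Ll).
    by move/ffunP/(_ (R :* x)); rewrite ind_repE invgK.
  rewrite (rcosets_orbit_sum sRG sLG Gx (fixv_left_inv repG sRG (subxx G) fixux)).
  have xR : R :^ x = R := normP (subsetP (normal_norm nsRG) x Gx).
  rewrite xR (setIidPl sRL); apply/memv_imgP; exists (r x (u (R :* x))).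
    exact: stabS.
  rewrite rtrE; apply: eq_bigr => C /(repr_rcosets sRL)[Lc _].
  by rewrite (repM repG) // (subsetP sLG).
move=> a Sa ->; apply/memv_imgP.
pose u : U := [ffun C => if C \in rcosets R L then a else 0].
have sLRG : rcosets R L \subset rcosets R G by apply: imsetS.
exists u; last first.
  rewrite rtrE ind_sumE [RHS](big_setID (rcosets R L)) /=.
  rewrite (setIidPr sLRG) [X in _ + X]big1 ?addr0 => [|C /setDP[_ /negPf nC]].
    by apply: eq_bigr => C LC; rewrite ffunE LC.
  by rewrite ffunE nC linear0.
rewrite memv_cap; apply/andP; split.
  apply/ind_spaceP; split=> [C | C nC]; rewrite ffunE.
    by case: ifP; rewrite ?mem0v.
  by rewrite (negPf (contra (subsetP sLRG C) nC)).
apply/fixvP=> l Ll; apply/ffunP=> C; rewrite ind_repE !ffunE.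
have actsLL := actsRs_rcosets R L; have Lv := groupVr Ll.
by have := acts_act actsLL Lv C; rewrite /= rcosetE => ->.
Qed.

Definition ind_ker : {vspace U} := (ind_space :&: (ind_sum @^-1: T))%VS.

Lemma ind_ker_stable : {in G, forall g (u : U), u \in ind_ker -> ind_rep g u \in ind_ker}.
Proof.
move=> g Gg u /memv_capP[Iu]; rewrite -memv_preim => Tu.
by rewrite memv_cap ind_space_stable // -memv_preim ind_sum_equiv ?stabT.
Qed.

(** This turns images of traces into fixed points of two modules on which R acts trivially: the
    induced module and the preimage of T in it. *)
Lemma dim_tr_ind L : R \subset L -> L \subset G ->
  (\dim (rtr r R L @: S + T))%:Z - (\dim T)%:Z =
  (\dim (ind_space :&: fixv ind_rep L))%:Z - (\dim (ind_ker :&: fixv ind_rep L))%:Z.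
Proof.
move=> sRL sLG.
have := dim_img_add ind_sum (ind_space :&: fixv ind_rep L) T.
have -> : (ind_space :&: fixv ind_rep L :&: (ind_sum @^-1: T) =
    ind_ker :&: fixv ind_rep L)%VS.
  by rewrite /ind_ker -!capvA; congr (_ :&: _)%VS; apply: capvC.
rewrite ind_sum_fixv //.
move: (\dim (_ + T)) (\dim (ind_ker :&: _)) (\dim T) (\dim (_ :&: _)) => a b c d.
by lia.
Qed.

End Induced.

Lemma null_tr_index G R (V : vectType F) (r : gT -> 'End(V)) (S T : {vspace V}) :
    R <| G -> null_modules G R -> is_rep G r -> (S <= fixv r R)%VS ->
    {in G, forall g v, v \in S -> r g v \in S} ->
    {in G, forall g v, v \in T -> r g v \in T} ->
  null_sum p G R (fun L => (\dim (rtr r R L @: S + T))%:Z - (\dim T)%:Z).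
Proof.
move=> nsRG nullR repG fixS stabS stabT; have sRG := normal_sub nsRG.
have repI := is_rep_ind V G; have trivI := ind_space_triv (V := V) (S := S) nsRG.
apply: (eq_null_sum (fun L sRL sLG =>
  esym (dim_tr_ind T nsRG repG fixS stabS sRL sLG))).
apply: null_sumB.
  apply: (null_submodule nullR sRG repI).
    exact: ind_space_stable.
  exact: trivI.
apply: (null_submodule nullR sRG repI).
  exact: ind_ker_stable.
by move=> g Rg u /memv_capP[Iu _]; apply: trivI.
Qed.

End InducedModules.

(** * Additivity on exact sequences *)

Lemma cyclic_modS p (gT : finGroupType) (C D : {group gT}) :
  C \subset D -> cyclic_mod p D -> cyclic_mod p C.
Proof.
case: p => [|p] sCD /=; first exact: cyclicS.
case=> P [nsPD pP cycD]; exists (P :&: C)%G.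
have [_ nPD] := andP nsPD; have nPC := subset_trans sCD nPD.
split; first by rewrite /normal subsetIr normsI ?normG.
  exact: pgroupS (subsetIl _ _) pP.
by rewrite (isog_cyclic (second_isog nPC)) (cyclicS _ cycD) ?quotientS.
Qed.

Section Restriction.

Local Open Scope ring_scope.

(** Burnside's theorem for L, all of whose subgroups are cyclic mod p: the weight [eL] of the
    restriction has no fixed points under any J in L, so descending induction on J shows that it is
    zero. *)
Lemma null_sum_restrict p (gT : finGroupType) (G Q L : {group gT})
    (e phi : {group gT} -> int) :
    null_weight p G Q e -> L \subset G -> cyclic_mod p L ->
  (\sum_(K : {group gT}) e K * (#|K :&: L|%:Z * phi (K :&: L)%G) = 0)%R.
Proof.
move=> null_e sLG cycL.
pose eL (J : {group gT}) : int :=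
  \sum_(K : {group gT} | (K :&: L)%G == J) e K.
have eL_out (J : {group gT}) : ~~ (J \subset L) -> eL J = 0.
  move=> nsJL; rewrite /eL big_pred0 // => K; apply: contraNF nsJL => /eqP <-.
  exact: subsetIr.
have eL0 (J : {group gT}) : eL J = 0.
  have [sJL | /eL_out //] := boolP (J \subset L).
  have [n lenJ] := ubnP (#|L| - #|J|); elim: n J lenJ sJL => // n IHn J lenJ sJL.
  have := proj2 null_e J (subset_trans sJL sLG) (cyclic_modS sJL cycL).
  rewrite (partition_big (fun K => (K :&: L)%G) (fun J' : {group gT} => J \subset J')) /=; last first.
    by move=> K sJK; rewrite subsetI sJK.
  rewrite (bigD1 J) //= [X in _ + X]big1 ?addr0 => [<-|J' /andP[sJJ' neqJ]].
    apply: eq_bigl => K; apply/esym/andb_idl => /eqP <-; exact: subsetIl.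
  transitivity (eL J').
    apply: eq_bigl => K; apply/andb_idl => /eqP defJ'.
    by apply: subset_trans sJJ' _; rewrite -defJ' subsetIl.
  have [sJL' | /eL_out //] := boolP (J' \subset L).
  apply: IHn => //; have := subset_leq_card sJL'.
  have : J \proper J' by rewrite properEneq sJJ' eq_sym andbT.
  move/proper_card; move: (#|J|) (#|J'|) (#|L|) lenJ => a b c; lia.
rewrite (partition_big (fun K => (K :&: L)%G) predT) //= big1 // => J _.
rewrite (eq_bigr (fun K => e K * (#|J|%:Z * phi J))) => [|K /eqP <- //].
by rewrite -mulr_suml -/(eL J) eL0 mul0r.
Qed.

End Restriction.

Section NullFamilies.

Local Open Scope ring_scope.

Variables (F : fieldType) (p : nat) (gT : finGroupType) (G Q : {group gT}).
Variable e : {group gT} -> int.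
Hypotheses (p_pr : prime p) (charF : p \in [pchar F]).
Hypotheses (nsQG : Q <| G) (pQ : p.-group Q) (null_e : null_weight p G Q e).
Hypothesis null_norm : forall R : {group gT}, Q \subset R -> R \subset G ->
  p.-group R -> (#|Q| < #|R|)%N -> null_modules F p 'N_G(R)%G R.
Implicit Types K L J R : {group gT}.

Definition null_dim (V : vectType F) (A : {group gT} -> {vspace V}) : int :=
  \sum_(K : {group gT}) e K * (#|K|%:Z * (\dim (A K))%:Z).

Section Exactness.

Variables (V1 V2 : vectType F) (r1 : gT -> 'End(V1)) (r2 : gT -> 'End(V2)).
Hypotheses (rep1 : is_rep G r1) (rep2 : is_rep G r2).
Hypothesis triv1 : {in Q, forall g v, r1 g v = v}.
Variable d : 'Hom(V1, V2).
Hypothesis equiv_d : {in G, forall g v, d (r1 g v) = r2 g (d v)}.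

Lemma equiv_rtr L K v : L \subset K -> K \subset G ->
  d (rtr r1 L K v) = rtr r2 L K (d v).
Proof.
move=> sLK sKG; rewrite !rtrE linear_sum /=; apply: eq_bigr => C.
by case/(repr_rcosets sLK) => Kr _; rewrite equiv_d // (subsetP sKG).
Qed.

Lemma mackey_img : mackey G Q r2 (fun K => (d @: fixv r1 K)%VS).
Proof.
split=> [K sQK sKG | L K sQL sLK sKG | K g v sQK sKG Gg | L K v sQL sLK sKG].
- apply/subvP=> _ /memv_imgP[v /fixvP fixv ->]; apply/fixvP=> g Kg.
  by rewrite -equiv_d ?fixv // (subsetP sKG).
- by apply: limgS; apply: fixvS.
- case/memv_imgP=> w fixw ->; rewrite -equiv_d // memv_img //.
  exact: (fixv_conj rep1 sKG Gg fixw).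
case/memv_imgP=> w fixw ->; rewrite -equiv_rtr // memv_img //.
exact: (rtr_fixv rep1 sLK sKG fixw).
Qed.

Lemma mackey_cap : mackey G Q r2 (fun K => (limg d :&: fixv r2 K)%VS).
Proof.
have stab g v : g \in G -> v \in limg d -> r2 g v \in limg d.
  by move=> Gg /memv_imgP[w _ ->]; rewrite -equiv_d // memv_img ?memvf.
split=> [K sQK sKG | L K sQL sLK sKG | K g v sQK sKG Gg | L K v sQL sLK sKG].
- exact: capvSr.
- by apply: capvS => //; apply: fixvS.
- case/memv_capP=> iv fixv; rewrite memv_cap stab //.
  exact: (fixv_conj rep2 sKG Gg fixv).
case/memv_capP=> iv fixv; rewrite memv_cap (rtr_fixv rep2 sLK sKG fixv) andbT.
rewrite rtrE memv_suml // => C /(repr_rcosets sLK)[Kr _].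
by rewrite stab ?(subsetP sKG).
Qed.

(** The defect of additivity compares the fixed points in the image of [d] with the image of the
    fixed points. These two Mackey families agree at Q, which acts trivially on V1, so
    [null_mackey_diff] applies. *)
Lemma null_dim_exact :
  null_dim (fixv r1) = null_dim (fun K => lker d :&: fixv r1 K)%VS
                       + null_dim (fun K => limg d :&: fixv r2 K)%VS.
Proof.
have null_tau R (S T : {vspace V2}) :
    Q \subset R -> R \subset G -> p.-group R -> (#|Q| < #|R|)%N ->
    (S <= fixv r2 R)%VS -> {in 'N_G(R), forall g v, v \in S -> r2 g v \in S} ->
    {in 'N_G(R), forall g v, v \in T -> r2 g v \in T} ->
  null_sum p 'N_G(R) R
    (fun L => (\dim (rtr r2 R L @: S + T))%:Z - (\dim T)%:Z).
  move=> sQR sRG pR ltQR fixS stabS stabT.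
  apply: (null_tr_index (normalSG sRG) (null_norm sQR sRG pR ltQR)) => //.
  exact: is_repS (subsetIl _ _).
have sBA (K : {group gT}) : Q \subset K -> K \subset G ->
    (d @: fixv r1 K <= limg d :&: fixv r2 K)%VS.
  move=> sQK sKG; apply/subvP=> _ /memv_imgP[v fixv ->].
  rewrite memv_cap memv_img ?memvf //=; apply/fixvP=> g Kg.
  by rewrite -equiv_d ?(subsetP sKG) //; move/fixvP: fixv => ->.
have sAB : (limg d :&: fixv r2 Q <= d @: fixv r1 Q)%VS.
  apply/subvP=> w /memv_capP[/memv_imgP[v _ ->] _]; apply: memv_img.
  by apply/fixvP=> g Qg; rewrite triv1.
have := null_mackey_diff p_pr charF rep2 nsQG pQ null_e null_tau
  mackey_cap mackey_img sBA sAB.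
rewrite (eq_bigr (fun K : {group gT} =>
  e K * (#|K|%:Z * (\dim (limg d :&: fixv r2 K))%:Z) +
  (e K * (#|K|%:Z * (\dim (lker d :&: fixv r1 K))%:Z) -
   e K * (#|K|%:Z * (\dim (fixv r1 K))%:Z)))); last first.
  move=> K _; have <- := limg_ker_dim d (fixv r1 K).
  by rewrite [(lker d :&: _)%VS]capvC PoszD; ring.
rewrite big_split sumrB /= => eq0; apply/eqP.
by rewrite -subr_eq0 -oppr_eq0 -[X in _ == X]eq0 /null_dim; apply/eqP; ring.
Qed.

End Exactness.

(** By [null_dim_exact] both sides are the sum of the contributions of the same two submodules. With
    one map zero this covers isomorphisms; with both nonzero it compares reductions mod p of two
    lattices. *)
Lemma null_dim_periodic (V1 V2 : vectType F) (r1 : gT -> 'End(V1))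
    (r2 : gT -> 'End(V2)) (d : 'Hom(V1, V2)) (d' : 'Hom(V2, V1)) :
    is_rep G r1 -> is_rep G r2 ->
    {in Q, forall g v, r1 g v = v} -> {in Q, forall g v, r2 g v = v} ->
    {in G, forall g v, d (r1 g v) = r2 g (d v)} ->
    {in G, forall g v, d' (r2 g v) = r1 g (d' v)} ->
    lker d = limg d' -> lker d' = limg d ->
  null_dim (fixv r1) = null_dim (fixv r2).
Proof.
move=> rep1 rep2 triv1 triv2 equiv_d equiv_d' kerd kerd'.
rewrite (null_dim_exact rep1 rep2 triv1 equiv_d).
by rewrite (null_dim_exact rep2 rep1 triv2 equiv_d') kerd kerd' addrC.
Qed.

End NullFamilies.

(** * Permutation and integral representations *)

Section PermutationReps.

Local Open Scope ring_scope.

Variables (F : fieldType) (gT : finGroupType) (G : {group gT}).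
Variables (V : vectType F) (r : gT -> 'End(V)) (I : finType) (to : action G I).
Hypothesis repG : is_rep G r.
Implicit Types (K L : {group gT}).

Notation U := {ffun I -> V}.

(** The diagonal action on functions from I to V, that is, on V tensored with the permutation module
    of I. *)
Definition perm_fun g (u : U) : U := [ffun z => r g (u (to z g^-1%g))].

Fact perm_fun_linear g : linear (perm_fun g).
Proof. by move=> a u v; apply/ffunP=> z; rewrite !ffunE linearP. Qed.
HB.instance Definition _ g :=
  GRing.isLinear.Build F U U *:%R (perm_fun g) (perm_fun_linear g).

Definition perm_rep g : 'End(U) := linfun (perm_fun g).

Lemma perm_repE g (u : U) z : perm_rep g u z = r g (u (to z g^-1%g)).
Proof. by rewrite lfunE /= ffunE. Qed.

Lemma is_rep_perm : is_rep G perm_rep.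
Proof.
split=> [|g h Gg Gh]; apply/lfunP=> u; apply/ffunP=> z.
  by rewrite perm_repE id_lfunE invg1 act1 (rep1 repG).
by rewrite comp_lfunE !perm_repE invMg actMin ?groupV // (repM repG).
Qed.

Lemma fixv_permP K (u : U) : K \subset G ->
  reflect {in K, forall g z, u (to z g) = r g (u z)} (u \in fixv perm_rep K).
Proof.
move=> sKG; apply: (iffP (fixvP _ _ _)) => fixu g Kg; last first.
  apply/ffunP=> z; rewrite perm_repE -fixu //.
  by rewrite -actMin ?groupV ?(subsetP sKG) // mulVg act1.
move=> z; have Gg := subsetP sKG g Kg.
rewrite -[in LHS](fixu g Kg) perm_repE.
by rewrite -actMin ?groupV // mulgV act1.
Qed.

Definition eval_fun z (u : U) : V := u z.

Fact eval_fun_linear z : linear (eval_fun z).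
Proof. by move=> a u v; rewrite /eval_fun !ffunE. Qed.
HB.instance Definition _ z :=
  GRing.isLinear.Build F U V *:%R (eval_fun z) (eval_fun_linear z).

Lemma dim_fixv_conj K g : K \subset G -> g \in G ->
  \dim (fixv r (K :^ g)) = \dim (fixv r K).
Proof.
move=> sKG Gg; have -> : fixv r (K :^ g) = (r g @: fixv r K)%VS.
  apply/vspaceP=> v; apply/idP/memv_imgP=> [fixv | [w fixw ->]]; last first.
    exact: (fixv_conj repG sKG Gg fixw).
  exists (r g^-1%g v); last by rewrite (repKV repG).
  have sKgG : (K :^ g)%G \subset G by rewrite -(conjGid Gg) conjSg.
  have := fixv_conj repG sKgG (groupVr Gg) fixv.
  by rewrite conjsgK.
apply/limg_dim_eq/eqP; rewrite -subv0; apply/subvP=> v /memv_capP[_].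
rewrite memv_ker memv0 => /eqP rv0; apply/eqP.
by rewrite -(repK repG v Gg) rv0 linear0.
Qed.

Lemma mem_astab1 K z g : K \subset G ->
  (g \in 'C_K[z | to]) = (g \in K) && (to z g == z).
Proof.
move=> sKG; rewrite inE; have [Kg | //] := boolP (g \in K).
by rewrite inE (subsetP sKG) //= inE sub1set inE.
Qed.

(** An equivariant function is determined on each orbit by its value at one point z, an arbitrary
    vector fixed by the stabiliser of z. The factors [#|'C_K[z | to]|] avoid choosing a point in
    each orbit; the proof removes one orbit at a time from the support S. *)
Lemma dim_fixv_perm K : K \subset G ->
  (#|K| * \dim (fixv perm_rep K) =
   \sum_z #|'C_K[z | to]| * \dim (fixv r 'C_K[z | to]))%N.
Proof.
move=> sKG.
pose W (S : {set I}) :=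
  (fixv perm_rep K :&: \bigcap_(z | z \notin S) lker (linfun (eval_fun z)))%VS.
have memW (S : {set I}) (u : U) : reflect
    ({in K, forall g z, u (to z g) = r g (u z)} /\ (forall z, z \notin S -> u z = 0))
    (u \in W S).
  apply: (iffP memv_capP) => -[fixu u0]; split; try exact/(fixv_permP _ sKG).
    move=> z nSz; move: u0; rewrite memvE => /subv_bigcapP/(_ z nSz).
    by rewrite -memvE memv_ker lfunE => /eqP.
  rewrite memvE; apply/subv_bigcapP=> z nSz.
  by rewrite -memvE memv_ker lfunE /=; apply/eqP/u0.
suff dimW (S : {set I}) : {in S & K, forall z g, to z g \in S} ->
    (#|K| * \dim (W S) =
     \sum_(z in S) #|'C_K[z | to]| * \dim (fixv r 'C_K[z | to]))%N.
  have -> : fixv perm_rep K = W setT.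
    apply/vspaceP=> u; apply/(fixv_permP _ sKG)/memW => [fixu|[]//].
    by split=> // z; rewrite inE.
  rewrite dimW => [|z g _ _]; last by rewrite inE.
  by apply: eq_bigl => z; rewrite inE.
have [n leSn] := ubnP #|S|; elim: n S leSn => // n IHn S leSn stabS.
have [-> | [z Sz]] := set_0Vmem S.
  rewrite big_set0; suff -> : W set0 = 0%VS by rewrite dimv0 muln0.
  apply/eqP; rewrite -subv0; apply/subvP=> u /memW[_ u0].
  by rewrite memv0; apply/eqP/ffunP=> z; rewrite u0 ?inE // ffunE.
pose O := orbit to K z; pose C := 'C_K[z | to].
have Oz : z \in O by apply: orbit_refl.
have sOS : O \subset S by apply/subsetP=> _ /imsetP[g Kg ->]; apply: stabS.
have stabO y g : g \in K -> (to y g \in O) = (y \in O).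
  by move=> Kg; apply: orbit_actr_in.
have{IHn} IHO : (#|K| * \dim (W (S :\: O)) =
    \sum_(z in S :\: O) #|'C_K[z | to]| * \dim (fixv r 'C_K[z | to]))%N.
  apply: IHn => [|y g /setDP[Sy nOy] Kg]; last by rewrite inE stabO // nOy stabS.
  apply: leq_trans (ltnSE leSn); rewrite [leqRHS](cardsD1 z) Sz ltnS.
  by rewrite subset_leq_card // setDS // sub1set.
have kerW : (W S :&: lker (linfun (eval_fun z)) = W (S :\: O)%SET)%VS.
  apply/vspaceP=> u; rewrite memv_cap memv_ker lfunE /= /eval_fun.
  apply/andP/memW => [[/memW[fixu u0] /eqP uz0] | [fixu u0]].
    split=> // y; rewrite inE negb_and negbK => /orP[/imsetP[g Kg ->] | /u0 //].
    by rewrite fixu // uz0 linear0.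
  split; last by rewrite u0 // inE Oz.
  by apply/memW; split=> // y nSy; rewrite u0 // inE (negPf nSy) andbF.
have CP g : g \in C -> g \in K /\ to z g = z.
  by rewrite mem_astab1 // => /andP[Kg /eqP].
have imgW : (linfun (eval_fun z) @: W S = fixv r C)%VS.
  apply/vspaceP=> v; apply/memv_imgP/fixvP=> [[u /memW[fixu _] ->] g /CP[Kg zg] | fixv].
    by rewrite lfunE /= /eval_fun -fixu // zg.
  (* An element of K that moves z to y; the default value never matters, as [k] is only used on the
     orbit of z. *)
  pose k y := odflt 1%g [pick g in K | to z g == y].
  have kP y : y \in O -> k y \in K /\ to z (k y) = y.
    case/imsetP=> g Kg ->; rewrite /k; case: pickP => [h /andP[Kh /eqP]//|/(_ g)].
    by rewrite /= Kg eqxx.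
  have rk g h : g \in K -> h \in K -> to z g = to z h -> r g v = r h v.
    move=> Kg Kh eqz; have [Gg Gh] := (subsetP sKG g Kg, subsetP sKG h Kh).
    rewrite -(mulgKV h g) (repM repG) ?groupM ?groupV // fixv //.
    rewrite mem_astab1 // groupM ?groupV //=; apply/eqP.
    by rewrite actMin ?groupV // eqz -actMin ?groupV // mulgV act1.
  pose u : U := [ffun y => if y \in O then r (k y) v else 0].
  exists u; last first.
    rewrite lfunE /= /eval_fun ffunE Oz; have [Kk zk] := kP z Oz.
    by rewrite (rk _ 1%g) // ?act1 // (rep1 repG).
  apply/memW; split=> [g Kg y | y nSy]; last first.
    by rewrite ffunE (negPf (contra (subsetP sOS y) nSy)).
  rewrite !ffunE stabO //; case: ifP => [Oy | _]; last by rewrite linear0.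
  have [Kk zk] := kP y Oy; have [Kk' zk'] : k (to y g) \in K /\ to z (k (to y g)) = to y g.
    by apply: kP; rewrite stabO.
  rewrite -(repM repG) ?(subsetP sKG _ Kk) ?(subsetP sKG _ Kg) //.
  apply: rk; rewrite ?groupM // zk' actMin ?zk //; exact: (subsetP sKG).
rewrite (big_setID O) /= (setIidPr sOS) -IHO -kerW.
rewrite -[in LHS](limg_ker_dim (linfun (eval_fun z)) (W S)) imgW mulnDr addnC.
congr (_ + _)%N; rewrite (eq_bigr (fun=> (#|C| * \dim (fixv r C))%N)) => [|y].
  by rewrite sum_nat_const mulnA card_orbit_in_stab.
case/imsetP=> g Kg ->; have Gg := subsetP sKG g Kg.
have -> : 'C_K[to z g | to] = C :^ g.
  by rewrite astab1_act_in // /C [RHS]conjIg (conjGid Kg).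
have sCG : ('C_K[z | to])%G \subset G by rewrite subIset ?sKG.
by rewrite cardJg (dim_fixv_conj sCG Gg).
Qed.

End PermutationReps.

(** * Matrix representations, over F and over the integers *)

Definition is_mxrep (R : pzRingType) n (gT : finGroupType) (G Q : {set gT})
    (A : gT -> 'M[R]_n) :=
  [/\ A 1%g = (1%:M)%R, {in G &, forall g h, A (g * h)%g = (A g *m A h)%R}
    & {in Q, forall g, A g = (1%:M)%R}].

Section MatrixReps.

Local Open Scope ring_scope.

Variables (F : fieldType) (V : vectType F) (n : nat).
Implicit Types (M N : 'M[F]_n) (h : 'End(V)).

Notation U := {ffun 'I_n -> V}.

Definition mx_fun M (u : U) : U := [ffun j => \sum_i M i j *: u i].

Fact mx_fun_linear M : linear (mx_fun M).
Proof.
move=> a u v; apply/ffunP=> j; rewrite !ffunE scaler_sumr -big_split /=.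
by apply: eq_bigr => i _; rewrite !ffunE scalerDr !scalerA mulrC.
Qed.
HB.instance Definition _ M :=
  GRing.isLinear.Build F U U *:%R (mx_fun M) (mx_fun_linear M).

Definition mx_act M : 'End(U) := linfun (mx_fun M).

Lemma mx_actE M (u : U) j : mx_act M u j = \sum_i M i j *: u i.
Proof. by rewrite lfunE /= ffunE. Qed.

Lemma mx_actM M N u : mx_act (M *m N) u = mx_act N (mx_act M u).
Proof.
apply/ffunP=> j; rewrite !mx_actE.
under eq_bigr => i _ do rewrite mxE scaler_suml.
rewrite exchange_big; apply: eq_bigr => k _; rewrite mx_actE scaler_sumr.
by apply: eq_bigr => i _; rewrite scalerA mulrC.
Qed.

Lemma mx_act_diag (d : 'rV_n) (u : U) j : mx_act (diag_mx d) u j = d 0 j *: u j.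
Proof.
rewrite mx_actE (bigD1 j) //= mxE eqxx mulr1n big1 ?addr0 // => i neq_ij.
by rewrite mxE (negPf neq_ij) scale0r.
Qed.

Lemma mx_act1 u : mx_act 1%:M u = u.
Proof.
apply/ffunP=> j; rewrite mx_actE (bigD1 j) //= mxE eqxx scale1r big1 ?addr0 //.
by move=> i neq_ij; rewrite mxE (negPf neq_ij) scale0r.
Qed.

Lemma mx_act0 u : mx_act 0 u = 0.
Proof.
by apply/ffunP=> j; rewrite mx_actE big1 ?ffunE // => i _; rewrite mxE scale0r.
Qed.

Definition pt_fun h (u : U) : U := [ffun j => h (u j)].

Fact pt_fun_linear h : linear (pt_fun h).
Proof. by move=> a u v; apply/ffunP=> j; rewrite !ffunE linearP. Qed.
HB.instance Definition _ h :=
  GRing.isLinear.Build F U U *:%R (pt_fun h) (pt_fun_linear h).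

Definition pt_act h : 'End(U) := linfun (pt_fun h).

Lemma pt_actE h (u : U) j : pt_act h u j = h (u j).
Proof. by rewrite lfunE /= ffunE. Qed.

Lemma mx_act_pt M h u : mx_act M (pt_act h u) = pt_act h (mx_act M u).
Proof.
apply/ffunP=> j; rewrite mx_actE pt_actE mx_actE linear_sum /=.
by apply: eq_bigr => i _; rewrite linearZ /= pt_actE.
Qed.

Variables (gT : finGroupType) (r : gT -> 'End(V)).

(** The tensor product of V with the module of row vectors defined by A. *)
Definition tens_rep (A : gT -> 'M[F]_n) g : 'End(U) :=
  (mx_act (A g) \o pt_act (r g))%VF.

Lemma tens_repE A g (u : U) j : tens_rep A g u j = \sum_i A g i j *: r g (u i).
Proof.
by rewrite comp_lfunE mx_actE; apply: eq_bigr => i _; rewrite pt_actE.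
Qed.

Lemma tens_rep_equiv A B M g u : A g *m M = M *m B g ->
  mx_act M (tens_rep A g u) = tens_rep B g (mx_act M u).
Proof.
by move=> AM; rewrite !comp_lfunE -mx_actM AM mx_actM mx_act_pt.
Qed.

Lemma is_rep_tens (G : {group gT}) (Q : {set gT}) A :
  is_rep G r -> is_mxrep G Q A -> is_rep G (tens_rep A).
Proof.
move=> repG [A1 AM _]; split=> [|g h Gg Gh]; apply/lfunP=> u; rewrite !comp_lfunE.
  rewrite A1 mx_act1 id_lfunE; apply/ffunP=> j.
  by rewrite pt_actE (rep1 repG).
rewrite -mx_act_pt -mx_actM AM //; congr (mx_act _ _).
by apply/ffunP=> j; rewrite !pt_actE (repM repG).
Qed.

Lemma tens_rep_triv (G Q : {set gT}) A : is_mxrep G Q A ->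
  {in Q, forall g v, r g v = v} -> {in Q, forall g (u : U), tens_rep A g u = u}.
Proof.
case=> _ _ A1 r1 g Qg u; rewrite comp_lfunE A1 // mx_act1.
by apply/ffunP=> j; rewrite pt_actE r1.
Qed.

End MatrixReps.

(** E only has to be cancellable on the left, so that over the integers it may be any nonsingular
    matrix. *)
Lemma is_mxrep_conj (gT : finGroupType) (G : {group gT}) (Q : {set gT}) n
    (R : comPzRingType) (E : 'M[R]_n) (A B : gT -> 'M[R]_n) :
    Q \subset G -> injective (fun X : 'M[R]_n => E *m X)%R ->
    {in G, forall g, A g *m E = E *m B g}%R ->
  is_mxrep G Q A -> is_mxrep G Q B.
Proof.
move=> sQG injE AE [A1 AM A_Q]; split=> [|g h Gg Gh|g Qg]; apply: injE => /=.
- by rewrite -AE // A1 mul1mx mulmx1.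
- by rewrite -AE ?groupM // AM // -mulmxA AE // mulmxA AE // mulmxA.
by rewrite -AE ?(subsetP sQG) // A_Q // mul1mx mulmx1.
Qed.

Section IntegralReps.

Local Open Scope ring_scope.

Variables (F : fieldType) (p : nat) (gT : finGroupType) (G Q : {group gT}).
Variable e : {group gT} -> int.
Hypotheses (p_pr : prime p) (charF : p \in [pchar F]).
Hypotheses (nsQG : Q <| G) (pQ : p.-group Q) (null_e : null_weight p G Q e).
Hypothesis null_norm : forall R : {group gT}, Q \subset R -> R \subset G ->
  p.-group R -> (#|Q| < #|R|)%N -> null_modules F p 'N_G(R)%G R.
Variables (V : vectType F) (r : gT -> 'End(V)).
Hypotheses (repG : is_rep G r) (trivQ : {in Q, forall g v, r g v = v}).

Section Modular.

Variables (n : nat) (A B : gT -> 'M[F]_n).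
Hypotheses (repA : is_mxrep G Q A) (repB : is_mxrep G Q B).

Lemma null_dim_mx_periodic M N :
    {in G, forall g, A g *m M = M *m B g} -> {in G, forall g, B g *m N = N *m A g} ->
    lker (mx_act V M) = limg (mx_act V N) -> lker (mx_act V N) = limg (mx_act V M) ->
  null_dim e (fixv (tens_rep r A)) = null_dim e (fixv (tens_rep r B)).
Proof.
move=> AM BN kerM kerN.
apply: (null_dim_periodic p_pr charF nsQG pQ null_e null_norm _ _ _ _ _ _ kerM kerN).
- exact: is_rep_tens repG repA.
- exact: is_rep_tens repG repB.
- exact: tens_rep_triv repA trivQ.
- exact: tens_rep_triv repB trivQ.
- by move=> g Gg u; apply: tens_rep_equiv; apply: AM.
- by move=> g Gg u; apply: tens_rep_equiv; apply: BN.
Qed.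

Lemma null_dim_mx_unit M : M \in unitmx -> {in G, forall g, A g *m M = M *m B g} ->
  null_dim e (fixv (tens_rep r A)) = null_dim e (fixv (tens_rep r B)).
Proof.
(* With N = 0 the exactness conditions say that M acts bijectively. *)
move=> uM AM; apply: (null_dim_mx_periodic (N := 0) AM).
- by move=> g _; rewrite mulmx0 mul0mx.
- have -> : limg (mx_act V (0 : 'M[F]_n)) = 0%VS.
    apply/eqP; rewrite -subv0; apply/subvP=> _ /memv_imgP[u _ ->].
    by rewrite mx_act0 mem0v.
  apply/eqP/lker0P=> u v eq_uv.
  by rewrite -(mx_act1 u) -(mx_act1 v) -(mulmxV uM) !mx_actM eq_uv.
- apply/vspaceP=> u; rewrite memv_ker mx_act0 eqxx; apply/esym/memv_imgP.
  by exists (mx_act V (invmx M) u); rewrite ?memvf // -mx_actM mulVmx // mx_act1.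
Qed.

(** M and N are complementary coordinate projections, so the kernel of each is the image of the
    other. *)
Lemma null_dim_mx_diag (s : pred 'I_n) (M := diag_mx (\row_j (s j)%:R : 'rV[F]_n))
    (N := diag_mx (\row_j (~~ s j)%:R : 'rV[F]_n)) :
    {in G, forall g, A g *m M = M *m B g} -> {in G, forall g, B g *m N = N *m A g} ->
  null_dim e (fixv (tens_rep r A)) = null_dim e (fixv (tens_rep r B)).
Proof.
have memD (t : pred 'I_n) (u : {ffun 'I_n -> V}) :
    reflect (forall j, t j -> u j = 0)
            (u \in lker (mx_act V (diag_mx (\row_j (t j)%:R : 'rV[F]_n)))).
  rewrite memv_ker; apply: (iffP eqP) => [u0 j tj | u0].
    by have /ffunP/(_ j) := u0; rewrite mx_act_diag mxE tj scale1r ffunE.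
  apply/ffunP=> j; rewrite mx_act_diag mxE ffunE.
  by have [/u0 -> | _] := boolP (t j); rewrite ?scaler0 ?scale0r.
have imgD (t : pred 'I_n) (u : {ffun 'I_n -> V}) :
    reflect (forall j, ~~ t j -> u j = 0)
            (u \in limg (mx_act V (diag_mx (\row_j (t j)%:R : 'rV[F]_n)))).
  apply: (iffP memv_imgP) => [[w _ ->] j ntj | u0].
    by rewrite mx_act_diag mxE (negPf ntj) scale0r.
  exists u; rewrite ?memvf //; apply/ffunP=> j; rewrite mx_act_diag mxE.
  by have [_ | /u0 ->] := boolP (t j); rewrite ?scale1r ?scaler0.
move=> AM BN; apply: (null_dim_mx_periodic AM BN); apply/vspaceP=> u.
  apply/memD/imgD=> u0 j; first by rewrite negbK; apply: u0.
  by move=> sj; apply: u0; rewrite negbK.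
by apply/memD/imgD.
Qed.

End Modular.

Definition modp n (A : gT -> 'M[int]_n) g : 'M[F]_n := map_mx intr (A g).

Lemma is_mxrep_modp n (A : gT -> 'M[int]_n) : is_mxrep G Q A -> is_mxrep G Q (modp A).
Proof.
case=> A1 AM A_Q; split=> [|g h Gg Gh|g Qg]; rewrite /modp.
- by rewrite A1 map_mx1.
- by rewrite AM // map_mxM.
by rewrite A_Q // map_mx1.
Qed.

Lemma intr_pdvd (z : int) : (z%:~R == 0 :> F) = (p %| z)%Z.
Proof.
by rewrite (dvdz_pcharf charF).
Qed.

Lemma null_dim_integral_unit n (A B : gT -> 'M[int]_n) (M : 'M[int]_n) :
    is_mxrep G Q A -> is_mxrep G Q B -> ~~ (p %| \det M)%Z ->
    {in G, forall g, A g *m M = M *m B g} ->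
  null_dim e (fixv (tens_rep r (modp A))) = null_dim e (fixv (tens_rep r (modp B))).
Proof.
move=> repA repB pM AM; apply: (@null_dim_mx_unit _ _ _ _ _ (map_mx intr M)).
- exact: is_mxrep_modp.
- exact: is_mxrep_modp.
- by rewrite unitmxE det_map_mx unitfE intr_pdvd.
- by move=> g Gg; rewrite /modp -!map_mxM AM.
Qed.

(* Divide by p the diagonal entries divisible by p: the lattices in between are
   related by the exact sequences of [null_dim_mx_diag]. *)
Lemma null_dim_integral_diag n (A B : gT -> 'M[int]_n) (d : 'I_n -> int) :
    is_mxrep G Q A -> is_mxrep G Q B -> (forall i, d i != 0) ->
    {in G, forall g i j, A g i j * d j = d i * B g i j} ->
  null_dim e (fixv (tens_rep r (modp A))) = null_dim e (fixv (tens_rep r (modp B))).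
Proof.
move=> repA repB; have [m] := ubnP (\sum_i `|d i|)%N.
elim: m A repA d => // m IHm A repA d ltdm nzd AdB.
have p_gt1 := prime_gt1 p_pr; have nzp : p%:Z != 0 by rewrite -lt0n prime_gt0.
pose J i := (p %| d i)%Z.
have [/existsP[i0 Ji0] | /existsPn noJ] := boolP [exists i, J i]; last first.
  apply: (@null_dim_integral_unit _ _ _ (diag_mx (\row_j d j))) => // [|g Gg].
    rewrite det_diag -intr_pdvd rmorph_prod; apply/prodf_neq0 => i _.
    by rewrite mxE intr_pdvd; apply: noJ.
  apply/matrixP=> i j; rewrite mul_mx_diag mul_diag_mx !mxE.
  exact: AdB.
(* The products [eps i * eps' i] are all p, and modulo p the diagonals [eps] and [eps'] become the
   indicators of the complement of J and of J. *)
pose eps i : int := if J i then p%:Z else 1.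
pose eps' i : int := if J i then 1 else p%:Z.
(* This is A conjugated by the diagonal matrix [eps]. It is integral: for i in J and j outside J, p
   divides [A g i j * d j = d i * B g i j] but not [d j]. *)
pose A' g : 'M[int]_n := \matrix_(i, j)
  if J i then (if J j then A g i j else (A g i j %/ p)%Z)
  else (if J j then p%:Z * A g i j else A g i j).
have nzeps i : eps i != 0 by rewrite /eps; case: ifP.
have epsK i : eps i * eps' i = p%:Z.
  by rewrite /eps /eps'; case: ifP; rewrite ?mulr1 ?mul1r.
have epsF i : (eps i)%:~R = (~~ J i)%:R :> F.
  by rewrite /eps; case: ifP => //= _; apply/eqP; rewrite intr_pdvd.
have eps'F i : (eps' i)%:~R = (J i)%:R :> F.
  by rewrite /eps'; case: ifP => //= _; apply/eqP; rewrite intr_pdvd.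
have A'E g i j : g \in G -> A g i j * eps j = eps i * A' g i j.
  move=> Gg; rewrite mxE /eps.
  have [Ji | _] := boolP (J i); have [Jj | nJj] := boolP (J j).
  - by rewrite mulrC.
  - rewrite mulr1 mulrC divzK //.
    have : (p %| A g i j * d j)%Z by rewrite AdB // dvdz_mulr.
    by rewrite Gauss_dvdzl // coprimezE /= prime_coprime.
  - by rewrite mul1r mulrC.
  - by rewrite mulr1 mul1r.
have A'E' g i j : g \in G -> A' g i j * eps' j = eps' i * A g i j.
  move=> Gg; apply: (mulfI (nzeps i)); rewrite mulrA -A'E // -mulrA epsK.
  by rewrite mulrA epsK mulrC.
pose d' i := if J i then (d i %/ p)%Z else d i.
have dE i : d i = eps i * d' i.
  by rewrite /eps /d'; case: ifP => [Ji|]; rewrite ?mul1r // mulrC divzK.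
have mxE' g : g \in G -> A g *m diag_mx (\row_j eps j) = diag_mx (\row_j eps j) *m A' g.
  move=> Gg; apply/matrixP=> i j; rewrite mul_mx_diag mul_diag_mx !mxE.
  by rewrite A'E // mxE.
have repA' : is_mxrep G Q A'.
  apply: (is_mxrep_conj (normal_sub nsQG) _ mxE' repA) => X Y /= eqXY.
  apply/matrixP=> i j; apply: (mulfI (nzeps i)).
  by have /matrixP/(_ i j) := eqXY; rewrite !mul_diag_mx !mxE.
rewrite -(IHm A' repA' d') => [||i|g Gg i j].
- apply: (@null_dim_mx_diag _ _ _ _ _ (fun i => ~~ J i)) => [||g Gg|g Gg].
  + exact: is_mxrep_modp.
  + exact: is_mxrep_modp.
  + apply/matrixP=> i j; rewrite mul_mx_diag mul_diag_mx !mxE -!epsF -!rmorphM /=.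
    by rewrite A'E // !mxE.
  + apply/matrixP=> i j; rewrite mul_mx_diag mul_diag_mx !mxE !negbK -!eps'F.
    by rewrite -!rmorphM /= -A'E' // !mxE.
- apply: leq_trans (ltnSE ltdm); rewrite (bigD1 i0) //= [leqRHS](bigD1 i0) //=.
  rewrite -addSn leq_add //; last first.
    apply: leq_sum => i _; rewrite [in leqRHS]dE abszM leq_pmull // absz_gt0.
    exact: nzeps.
  have : d' i0 != 0 by apply: contra (nzd i0) => /eqP d0; rewrite dE d0 mulr0.
  rewrite [in leqRHS]dE abszM /eps Ji0 -absz_gt0 => d'_gt0.
  by rewrite ltn_Pmull.
- by apply: contra (nzd i) => /eqP d0; rewrite dE d0 mulr0.
apply: (mulfI (nzeps i)); rewrite mulrA -A'E // -mulrA -dE AdB //.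
by rewrite dE mulrA.
Qed.

(** With the Smith form M = L D R, the unimodular L and R replace A and B by conjugates that are
    intertwined by the diagonal matrix D. *)
Lemma null_dim_integral n (A B : gT -> 'M[int]_n) (M : 'M[int]_n) :
    is_mxrep G Q A -> is_mxrep G Q B -> \det M != 0 ->
    {in G, forall g, A g *m M = M *m B g} ->
  null_dim e (fixv (tens_rep r (modp A))) = null_dim e (fixv (tens_rep r (modp B))).
Proof.
move=> repA repB nzM AM.
have [L uL [R uR [d _ defM]]] := int_Smith_normal_form M.
set D := (\matrix_(i, j) _) in defM.
pose A' g := invmx L *m A g *m L; pose B' g := R *m B g *m invmx R.
have pU (X : 'M[int]_n) : X \in unitmx -> ~~ (p %| \det X)%Z.
  have p1 : ~~ (p %| 1)%N by rewrite dvdn1 neq_ltn prime_gt1 ?orbT.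
  by rewrite unitmxE qualifE /= => /orP[] /eqP ->.
have A'L g : A g *m L = L *m A' g by rewrite /A' !mulmxA mulmxV // mul1mx.
have B'R g : B' g *m R = R *m B g by rewrite /B' mulmxKV.
have repA' : is_mxrep G Q A'.
  apply: (is_mxrep_conj (normal_sub nsQG) _ (fun g _ => A'L g) repA).
  by apply: can_inj (mulKmx uL).
have BR g : B g *m invmx R = invmx R *m B' g.
  by rewrite /B' !mulmxA mulVmx // mul1mx.
have repB' : is_mxrep G Q B'.
  apply: (is_mxrep_conj (normal_sub nsQG) _ (fun g _ => BR g) repB).
  by apply: can_inj (mulKmx _); rewrite unitmx_inv.
rewrite (null_dim_integral_unit repA repA' (pU L uL)) //.
rewrite -(null_dim_integral_unit repB' repB (pU R uR)) //.
have DE : D = diag_mx (\row_(j < n) d`_j).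
  apply/matrixP=> i j; rewrite !mxE val_eqE.
  by case: eqP => [->|].
have A'D g : g \in G -> A' g *m D = D *m B' g.
  have LD : L *m D = M *m invmx R by rewrite defM mulmxK.
  have DR : D *m R = invmx L *m M by rewrite defM -mulmxA mulKmx.
  move=> Gg; rewrite /A' /B' -mulmxA LD !mulmxA DR -!mulmxA.
  by rewrite [A g *m _]mulmxA AM // -!mulmxA.
apply: (@null_dim_integral_diag _ _ _ (fun j => d`_j)) => // [i | g Gg i j].
  move: nzM; rewrite defM !det_mulmx DE det_diag !mulf_eq0 !negb_or.
  by case/andP=> /andP[_ /prodf_neq0/(_ i isT)]; rewrite mxE.
have /matrixP/(_ i j) := A'D g Gg.
by rewrite DE mul_mx_diag mul_diag_mx !mxE.
Qed.

End IntegralReps.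

(** * Permutation matrices and their integral intertwiners *)

Section PermMatrices.

Local Open Scope ring_scope.

Variables (gT : finGroupType) (G : {group gT}) (I : finType) (to : action G I).
Variables (n : nat) (b : 'I_n -> I).
Hypothesis bij_b : bijective b.

Definition act_mx (R : pzSemiRingType) g : 'M[R]_n :=
  \matrix_(i, j) (to (b i) g == b j)%:R.

Lemma is_mxrep_act (R : comPzRingType) (Q : {set gT}) :
  {in Q, forall g x, to x g = x} -> is_mxrep G Q (@act_mx R).
Proof.
have [a bK aK] := bij_b; have inj_b := can_inj bK; move=> trivQ.
split=> [|g h Gg Gh|g Qg]; apply/matrixP=> i j; rewrite !mxE.
- by rewrite act1 (inj_eq inj_b).
- rewrite (bigD1 (a (to (b i) g))) //= big1 ?addr0 => [|k neqk]; last first.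
    by rewrite !mxE eq_sym (can2_eq bK aK) (negPf neqk) mul0r.
  by rewrite !mxE aK eqxx mul1r -actMin.
by rewrite trivQ // (inj_eq inj_b).
Qed.

Lemma tr_act_mx (R : pzSemiRingType) g : \tr (act_mx R g) = #|'Fix_to[g]|%:R.
Proof.
have [a bK aK] := bij_b; rewrite -sum1_card natr_sum /mxtrace.
rewrite (reindex b) /=; last by exists a => x _; rewrite ?bK ?aK.
rewrite [RHS]big_mkcond; apply: eq_bigr => i _; rewrite mxE inE sub1set inE.
by case: eqP.
Qed.

Lemma act_mx_mulE (R : comPzRingType) m g (M : 'M[R]_(n, m)) i j k : b k = to (b i) g ->
  (act_mx R g *m M) i j = M k j.
Proof.
have [a bK aK] := bij_b; move=> bk; rewrite mxE (bigD1 k) //= mxE bk eqxx mul1r.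
rewrite big1 ?addr0 // => l neql; rewrite mxE -bk (inj_eq (can_inj bK)) eq_sym.
by rewrite (negPf neql) mul0r.
Qed.

Lemma mul_act_mxE (R : comPzRingType) m g (M : 'M[R]_(m, n)) i j k :
  g \in G -> b j = to (b k) g -> (M *m act_mx R g) i j = M i k.
Proof.
have [a bK aK] := bij_b; move=> Gg bj; rewrite mxE (bigD1 k) //= mxE bj eqxx mulr1.
rewrite big1 ?addr0 // => l neql; rewrite mxE bj (inj_eq (act_inj to g)).
by rewrite (inj_eq (can_inj bK)) (negPf neql) mulr0.
Qed.

End PermMatrices.

Definition intertwines (R : comPzRingType) (gT : finGroupType) (G : {group gT})
    (X Y : finType) (toX : action G X) (toY : action G Y) n
    (bX : 'I_n -> X) (bY : 'I_n -> Y) (B : 'M[R]_n) :=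
  {in G, forall g, act_mx toX bX R g *m B = B *m act_mx toY bY R g}%R.

(* A matrix is an intertwiner when it is constant on the orbits of pairs. *)
Lemma map_intertwiner (R S : comPzRingType) (f : R -> S) (gT : finGroupType)
    (G : {group gT}) (X Y : finType) (toX : action G X) (toY : action G Y) n
    (bX : 'I_n -> X) (bY : 'I_n -> Y) (B : 'M[R]_n) :
    bijective bX -> bijective bY ->
  intertwines toX toY bX bY B -> intertwines toX toY bX bY (map_mx f B).
Proof.
move=> bijX bijY XB g Gg; apply/matrixP=> i j.
have [aX _ aXK] := bijX; have [aY _ aYK] := bijY.
have bXi : bX (aX (toX (bX i) g)) = toX (bX i) g by [].
have bYj : bY j = toY (bY (aY (toY (bY j) g^-1))) g.
  by rewrite aYK -actMin ?groupV // mulVg act1.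
rewrite (act_mx_mulE bijX _ _ bXi) (mul_act_mxE bijY _ _ Gg bYj) !mxE.
congr (f _); have /matrixP/(_ i j) := XB g Gg.
by rewrite (act_mx_mulE bijX _ _ bXi) (mul_act_mxE bijY _ _ Gg bYj).
Qed.

Section IntegralPoint.

Local Open Scope ring_scope.

Lemma nonroot_nat (p : {poly algC}) : p != 0 -> exists c : nat, ~~ root p c%:R.
Proof.
move=> nzp; pose s : seq algC := [seq c%:R | c <- iota 0 (size p)].
have [|/allPn[_ /mapP[c _ ->] nrc]] := boolP (all (root p) s); last by exists c.
move=> rs; have us : uniq s.
  by rewrite map_inj_uniq ?iota_uniq // => c d /eqP; rewrite eqr_nat => /eqP.
by have := max_poly_roots nzp rs us; rewrite size_map size_iota ltnn.
Qed.

(** The coefficients v are replaced one by one by natural numbers: the determinant is a polynomial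
    in the coefficient under consideration, nonzero because it does not vanish at v. *)
Lemma det_integral_point n (s : seq algC) (E : algC -> 'M[int]_n)
    (P : 'M[int]_n -> Prop) (M0 : 'M[int]_n) :
    P M0 -> (forall M v c, v \in s -> P M -> P (M + c *: E v)) ->
    \det (map_mx intr M0 + \sum_(v <- s) v *: map_mx intr (E v) : 'M[algC]_n) != 0 ->
  exists2 M, P M & \det M != 0.
Proof.
elim: s M0 => [|v s IHs] M0 PM0 closedP.
  rewrite big_nil addr0 det_map_mx => nz; exists M0 => //.
  by apply: contra nz => /eqP ->.
rewrite big_cons => nz.
set S := \sum_(v <- s) _ in nz.
pose A : 'M[{poly algC}]_n :=
  map_mx polyC (map_mx intr M0 + S) + 'X *: map_mx polyC (map_mx intr (E v)).
have detA x : (\det A).[x] = \det (map_mx intr M0 + x *: map_mx intr (E v) + S).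
  rewrite -horner_evalE -det_map_mx; congr (\det _); apply/matrixP=> i j.
  rewrite /A !mxE /= ?horner_evalE hornerD hornerM hornerX !hornerC.
  by rewrite addrAC.
have nzA : \det A != 0.
  by apply: contra nz => /eqP A0; rewrite addrA -detA A0 horner0.
have [c] := nonroot_nat nzA; rewrite /root detA => nzc.
apply: (IHs (M0 + c%:Z *: E v)).
- by apply: closedP; rewrite ?mem_head.
- by move=> M w d sw; apply: closedP; rewrite inE sw orbT.
apply: contra nzc => /eqP <-; apply/eqP; congr (\det (_ + _)).
by rewrite map_mxD map_mxZ.
Qed.

End IntegralPoint.

(** Equal permutation characters give an invertible intertwiner B over the algebraic numbers. It is
    the sum of v times the 0-1 matrix [E v] of the positions of the entry v; each [E v] is again an
    intertwiner, so the coefficients can be made integral by [det_integral_point]. *)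
Lemma integral_intertwiner (gT : finGroupType) (G : {group gT}) (X Y : finType)
    (toX : action G X) (toY : action G Y) n (bX : 'I_n -> X) (bY : 'I_n -> Y) :
    bijective bX -> bijective bY ->
    {in G, forall g, #|'Fix_toX[g]| = #|'Fix_toY[g]|} ->
  exists2 M : 'M[int]_n, (\det M != 0)%R & intertwines toX toY bX bY M.
Proof.
move=> bijX bijY eqFix.
have triv1 (T : finType) (to : action G T) : {in [1 gT], forall g x, to x g = x}.
  by move=> g /set1P -> x; rewrite act1.
have [X1 XM _] := is_mxrep_act bijX algC (triv1 _ toX).
have [Y1 YM _] := is_mxrep_act bijY algC (triv1 _ toY).
pose rX := MxRepresentation (conj X1 XM : mx_repr G _).
pose rY := MxRepresentation (conj Y1 YM : mx_repr G _).
have /cfRepr_rsimP[B _ freeB XB] : cfRepr rX == cfRepr rY.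
  apply/eqP/cfunP=> g; rewrite !cfunE; case Gg: (g \in G) => //.
  by rewrite !tr_act_mx // eqFix.
rewrite row_free_unit unitmxE unitfE in freeB.
pose E v : 'M[int]_n := map_mx (fun b => (b == v)%:R%R) B.
pose s := undup [seq B i j | i <- enum 'I_n, j <- enum 'I_n].
have defB : B = (\sum_(v <- s) v *: map_mx intr (E v))%R.
  apply/matrixP=> i j; rewrite summxE.
  rewrite (bigD1_seq (B i j)) ?undup_uniq //=; last first.
    by rewrite mem_undup; apply/allpairsP; exists (i, j); rewrite !mem_enum.
  rewrite big1 => [|v nv]; last by rewrite !mxE eq_sym (negPf nv) mulr0.
  by rewrite !mxE eqxx mulr1 addr0.
have EP v : intertwines toX toY bX bY (E v) by apply: map_intertwiner.
have [|M v c _ PM g Gg||M PM nzM] :=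
    @det_integral_point n s E (intertwines toX toY bX bY) 0%R.
- by move=> g _; rewrite mulmx0 mul0mx.
- by rewrite mulmxDr mulmxDl -scalemxAr -scalemxAl PM // EP.
- by rewrite map_mx0 add0r -defB.
by exists M.
Qed.

Lemma null_dim_permE (F : fieldType) (p : nat) (gT : finGroupType)
    (G Q : {group gT}) (e : {group gT} -> int) (V : vectType F)
    (r : gT -> 'End(V)) (I : finType) (to : action G I) :
    null_weight p G Q e -> is_rep G r ->
  null_dim e (fixv (perm_rep r to)) =
  (\sum_z \sum_(K : {group gT}) e K *
     (#|K :&: 'C_G[z | to]|%:Z * (\dim (fixv r (K :&: 'C_G[z | to])))%:Z))%R.
Proof.
move=> null_e repG; rewrite exchange_big /=; apply: eq_bigr => K _.
rewrite -mulr_sumr; have [-> | /(proj1 null_e)[_ sKG]] := eqVneq (e K) 0%R.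
  by rewrite !mul0r.
rewrite -PoszM (dim_fixv_perm to repG sKG) (big_morph Posz PoszD (erefl _)).
congr (_ * _)%R.
by apply: eq_bigr => z _; rewrite setIA (setIidPl sKG) PoszM.
Qed.

Section PermIntegral.

Local Open Scope ring_scope.

Variables (F : fieldType) (p : nat) (gT : finGroupType) (G Q : {group gT}).
Variable e : {group gT} -> int.
Hypotheses (p_pr : prime p) (charF : p \in [pchar F]).
Hypotheses (nsQG : Q <| G) (pQ : p.-group Q) (null_e : null_weight p G Q e).
Hypothesis null_norm : forall R : {group gT}, Q \subset R -> R \subset G ->
  p.-group R -> (#|Q| < #|R|)%N -> null_modules F p 'N_G(R)%G R.
Variables (V : vectType F) (r : gT -> 'End(V)).
Hypotheses (repG : is_rep G r) (trivQ : {in Q, forall g v, r g v = v}).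

Lemma null_dim_act_mx (I : finType) (to : action G I) n (b : 'I_n -> I) :
    bijective b -> {in Q, forall g x, to x g = x} ->
  null_dim e (fixv (perm_rep r to)) =
  null_dim e (fixv (tens_rep r (modp F (act_mx to b int)))).
Proof.
move=> bijb trivI; have [a bK aK] := bijb.
pose reidx (u : {ffun I -> V}) : {ffun 'I_n -> V} := [ffun j => u (b j)].
have reidx_lin : linear reidx by move=> c u v; apply/ffunP=> j; rewrite !ffunE.
pose reidxL := GRing.isLinear.Build F _ _ *:%R reidx reidx_lin.
pose dL : {linear {ffun I -> V} -> {ffun 'I_n -> V}} := HB.pack reidx reidxL.
have dE u j : linfun dL u j = u (b j) by rewrite lfunE /= ffunE.
have repA := is_mxrep_modp F (is_mxrep_act bijb int trivI).
(* Renumbering the points is an isomorphism, which is exactness with [d' = 0]. *)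
apply: (null_dim_periodic p_pr charF nsQG pQ null_e null_norm (d := linfun dL) (d' := 0)).
- exact: is_rep_perm.
- exact: is_rep_tens repG repA.
- move=> g Qg u; apply/ffunP=> z; rewrite perm_repE trivQ //.
  by rewrite trivI ?groupV.
- exact: tens_rep_triv repA trivQ.
- move=> g Gg u; apply/ffunP=> j; rewrite dE perm_repE tens_repE.
  rewrite (bigD1 (a (to (b j) g^-1%g))) //= big1 => [|i neqi]; last first.
    rewrite !mxE; case: eqP => [bj|_]; last by rewrite scale0r.
    by case/eqP: neqi; rewrite -bj -actMin ?groupV // mulgV act1 bK.
  rewrite !mxE dE aK -actMin ?groupV // mulVg act1 eqxx scale1r addr0 //.
- by move=> g _ u; rewrite !zero_lfunE linear0.
- have -> : limg (0 : 'Hom({ffun 'I_n -> V}, {ffun I -> V})) = 0%VS.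
    by rewrite lim0g.
  apply/eqP/lker0P=> u v /ffunP eq_uv; apply/ffunP=> z.
  by have := eq_uv (a z); rewrite !dE aK.
apply/vspaceP=> w; rewrite memv_ker zero_lfunE eqxx; apply/esym/memv_imgP.
exists [ffun z => w (a z)]; rewrite ?memvf //.
by apply/ffunP=> j; rewrite dE ffunE bK.
Qed.

Lemma null_dim_perm_eq (X Y : finType) (toX : action G X) (toY : action G Y) :
    {in Q, forall g x, toX x g = x} -> {in Q, forall g y, toY y g = y} ->
    {in G, forall g, #|'Fix_toX[g]| = #|'Fix_toY[g]|} ->
  null_dim e (fixv (perm_rep r toX)) = null_dim e (fixv (perm_rep r toY)).
Proof.
move=> trivX trivY eqFix.
have cardFix1 (I : finType) (to : action G I) : #|'Fix_to[1%g]| = #|I|.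
  rewrite -cardsT; apply: eq_card => x; rewrite !inE sub1set inE act1.
  by rewrite eqxx.
have eqXY : #|X| = #|Y| by rewrite -(cardFix1 X toX) -(cardFix1 Y toY) eqFix.
have bijX : bijective (fun i : 'I_#|X| => enum_val i : X).
  exact: enum_val_bij.
have bijY : bijective (fun i : 'I_#|X| => enum_val (cast_ord eqXY i) : Y).
  apply: bij_comp (@enum_val_bij Y) _.
  by exists (cast_ord (esym eqXY)); [apply: cast_ordK | apply: cast_ordKV].
have [M nzM XM] := integral_intertwiner bijX bijY eqFix.
rewrite (null_dim_act_mx bijX trivX) (null_dim_act_mx bijY trivY).
apply: (null_dim_integral p_pr charF nsQG pQ null_e null_norm repG trivQ _ _ nzM XM).
  exact: is_mxrep_act.
exact: is_mxrep_act.
Qed.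

End PermIntegral.

(** * Fixed points of X_ and Y_ *)

Section FixedPointCounts.

Variables (gT : finGroupType) (G : {group gT}).
Implicit Types (K L : {group gT}) (C : {set gT}) (X Y : gset G).

Lemma card_fix_union X Y C :
  #|'Fix_(gset_act (gset_union X Y))(C)| =
  #|'Fix_(gset_act X)(C)| + #|'Fix_(gset_act Y)(C)|.
Proof.
rewrite -!sum1_card big_sumType /=; congr (_ + _)%N; apply: eq_bigl => x;
  by rewrite !inE; congr (_ \subset _); apply/setP=> a; rewrite !inE.
Qed.

Lemma card_fix_bigunion (I : finType) (Z : I -> gset G) C :
  #|'Fix_(gset_act (gset_bigunion Z))(C)| = \sum_i #|'Fix_(gset_act (Z i))(C)|.
Proof.
rewrite -sum1_card; under [RHS]eq_bigr do rewrite -sum1_card.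
rewrite sig_big_dep /=; apply: eq_bigl => -[i x] /=.
by rewrite !inE; apply/subsetP/subsetP=> fixx a /fixx; rewrite !inE eq_Tagged.
Qed.

Lemma card_fix_copies n X C :
  #|'Fix_(gset_act (gset_copies n X))(C)| = (n * #|'Fix_(gset_act X)(C)|)%N.
Proof. by rewrite card_fix_bigunion sum_nat_const card_ord. Qed.

(** The coset Kg is fixed by C exactly when C conjugated by the inverse of g lies in K, and it has
    [#|K|] elements. This is why [X_] and [Y_] contain [#|K|] copies of G/K. *)
Lemma card_fix_coset K C : K \subset G -> C \subset G ->
  (#|K| * #|'Fix_(gset_act (coset_gset G K))(C)|)%N =
  #|[set g in G | C :^ g^-1 \subset K]|.
Proof.
move=> sKG sCG.
have fixE g : (C :^ g^-1 \subset K) = [forall c in C, K :* g :* c == K :* g].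
  rewrite sub_conjgV; apply/subsetP/forall_inP=> sCK c Cc.
    rewrite -rcosetM; apply/eqP/rcoset_eqP; rewrite mem_rcoset.
    have -> : (g * c * g^-1 = c ^ g^-1)%g by rewrite conjgE invgK mulgA.
    by rewrite -mem_conjg sCK.
  have := sCK c Cc; rewrite -rcosetM => /eqP/rcoset_eqP; rewrite mem_rcoset mem_conjg.
  by rewrite conjgE invgK mulgA.
rewrite -[RHS]sum1_card (eq_bigl (fun g => (g \in G) && (C :^ g^-1 \subset K))); last first.
  by move=> g; rewrite inE.
rewrite big_mkcondr /= (set_partition_big _ (rcosets_partition sKG)) /=.
rewrite (eq_bigr (fun D => if [forall c in C, D :* c == D] then #|K| else 0))%N; last first.
  move=> D /rcosetsP[g Gg ->].
  rewrite (eq_bigr (fun=> if [forall c in C, K :* g :* c == K :* g] then 1 else 0))%N.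
    by rewrite sum_nat_const card_rcoset; case: ifP; rewrite ?muln1 ?muln0.
  by move=> h Kgh; rewrite fixE (rcoset_eqP Kgh).
rewrite -big_mkcondr sum_nat_const mulnC -(card_imset _ val_inj); congr (_ * _)%N.
apply: eq_card => D; rewrite [RHS]unfold_in /=; apply/imsetP/andP.
  case=> u; rewrite inE => /subsetP fixu ->; split; first exact: (valP u).
  apply/forall_inP=> c Cc; have := fixu c Cc; rewrite inE => /eqP/(congr1 val).
  by rewrite coset_gsetE ?(subsetP sCG) // => ->.
case=> KD /forall_inP fixD; exists (exist _ D KD) => //.
rewrite inE; apply/subsetP=> c Cc; rewrite inE; apply/eqP/val_inj.
by rewrite coset_gsetE ?(subsetP sCG) //; apply/eqP/fixD.
Qed.

Lemma stab_coset K u : K \subset G -> exists2 g, g \in G &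
  'C_G[u | gset_act (coset_gset G K)] = K :^ g.
Proof.
move=> sKG; have /rcosetsP[g Gg defu] := valP u; exists g => //.
apply/setP=> a; have [Ga | nGa] := boolP (a \in G); last first.
  rewrite inE (negPf nGa); apply/esym/negbTE; apply: contra nGa.
  by apply: subsetP; rewrite -(conjGid Gg) conjSg.
rewrite (mem_astab1 _ _ _ (subxx G)) Ga -val_eqE coset_gsetE //= defu -rcosetM.
rewrite mem_conjg conjgE invgK mulgA -mem_rcoset.
by apply/eqP/idP=> [<- | /rcoset_eqP //]; apply: rcoset_refl.
Qed.

Lemma sub_M_ l (M : 'I_l -> {group gT}) (S : {set 'I_l}) C :
  (C \subset M_ M S) = [forall i in S, C \subset M i].
Proof.
by apply/bigcapsP/forall_inP.
Qed.

(** For i in T, adding or removing i is an involution that changes the parity of S and preserves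
    inclusion in T. *)
Lemma alternating_subsets (I : finType) (T : {set I}) :
  ((T != set0) + \sum_(S : {set I} | (S != set0) && ~~ odd #|S|) (S \subset T) =
   \sum_(S : {set I} | (S != set0) && odd #|S|) (S \subset T))%N.
Proof.
have [-> | [i Ti]] := set_0Vmem T.
  rewrite eqxx !big1 // => S /andP[/negPf nzS _]; rewrite subset0 nzS //.
have -> : T != set0 by apply/set0Pn; exists i.
(* The leading 1 is the term of the empty set, which is even. *)
transitivity (\sum_(S : {set I} | ~~ odd #|S|) (S \subset T))%N.
  rewrite [RHS](bigD1 set0) ?cards0 //= sub0set; congr (_ + _)%N.
  by apply: eq_bigl => S; rewrite andbC.
rewrite [RHS](eq_bigl (fun S : {set I} => odd #|S|)); last first.
  by move=> S; apply: andb_idl; apply: contraL => /eqP ->; rewrite cards0.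
pose sw (S : {set I}) := if i \in S then S :\ i else i |: S.
have swK : involutive sw.
  move=> S; rewrite {2}/sw; have [Si | nSi] := boolP (i \in S).
    by rewrite /sw setD11 setD1K.
  by rewrite /sw setU11 setU1K.
rewrite (reindex_inj (inv_inj swK)) /=; apply: eq_big => S.
  rewrite /sw; have [Si | nSi] := boolP (i \in S).
    by rewrite [in RHS](cardsD1 i) Si.
  by rewrite cardsU1 nSi /= negbK.
move=> _; congr nat_of_bool; rewrite /sw; have [Si | nSi] := boolP (i \in S).
  by rewrite subDset (setUidPr _) ?sub1set.
by rewrite subUset sub1set Ti.
Qed.

(** Both numbers are sums over g in G. For each g let T be the set of i such that [M i] contains the
    conjugate of C by the inverse of g; T is nonempty exactly when H contains this conjugate, and
    [alternating_subsets] compares the summands. *)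
Lemma card_fix_XY l (M : 'I_l -> {group gT}) (H : {group gT}) C :
    C \subset G -> H \subset G -> (forall i, M i \subset H) ->
    (forall g, g \in G -> C :^ g \subset H -> exists i, C :^ g \subset M i) ->
  #|'Fix_(gset_act (X_ G M H))(C)| = #|'Fix_(gset_act (Y_ G M))(C)|.
Proof.
move=> sCG sHG sMH covC.
have sMG (S : {set 'I_l}) : S != set0 -> M_ M S \subset G.
  case/set0Pn=> i Si; apply: subset_trans (subset_trans (sMH i) sHG).
  exact: bigcap_inf.
have fixE (K : {group gT}) : K \subset G ->
    (#|K| * #|'Fix_(gset_act (coset_gset G K))(C)| = \sum_(g in G) (C :^ g^-1 \subset K))%N.
  move=> sKG; rewrite card_fix_coset // -sum1_card big_mkcond [RHS]big_mkcond /=.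
  by apply: eq_bigr => g _; rewrite inE; case: (g \in G) => //; case: (_ \subset _).
rewrite card_fix_union card_fix_copies fixE // card_fix_bigunion.
rewrite [RHS]card_fix_bigunion.
rewrite (eq_bigr (fun S : J_e l => \sum_(g in G) (C :^ g^-1 \subset M_ M (val S))))%N.
  rewrite [RHS](eq_bigr (fun S : J_o l => \sum_(g in G) (C :^ g^-1 \subset M_ M (val S))))%N.
    rewrite exchange_big [RHS]exchange_big -big_split /=; apply: eq_bigr => g Gg.
    pose T := [set i | C :^ g^-1 \subset M i].
    have subT S : (C :^ g^-1 \subset M_ M S) = (S \subset T).
      by rewrite sub_M_; apply/forall_inP/subsetP=> sST i /sST; rewrite inE.
    have bigJ (P : pred {set 'I_l}) (f : {set 'I_l} -> nat) :
        \sum_(S : {S | P S}) f (val S) = \sum_(S | P S) f S.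
      exact: esym (big_sub P f).
    rewrite (bigJ _ (fun S => C :^ g^-1 \subset M_ M S : nat)).
    rewrite (bigJ _ (fun S => C :^ g^-1 \subset M_ M S : nat)).
    under eq_bigr do rewrite subT.
    under [RHS]eq_bigr do rewrite subT.
    rewrite -alternating_subsets; congr (nat_of_bool _ + _)%N.
    apply/idP/set0Pn=> [/covC[] | [i]].
    - by rewrite groupV.
    - by move=> i sCM; exists i; rewrite inE.
    by rewrite inE => /subset_trans; apply.
  by move=> S _; rewrite card_fix_copies fixE // sMG; case/andP: (valP S).
by move=> S _; rewrite card_fix_copies fixE // sMG; case/andP: (valP S).
Qed.

End FixedPointCounts.

Section Stabilisers.

Variables (gT : finGroupType) (G : {group gT}).
Implicit Types X Y : gset G.

Lemma stab_inl X Y x :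
  'C_G[inl x | gset_act (gset_union X Y)] = 'C_G[x | gset_act X].
Proof. by apply/setP=> a; rewrite !mem_astab1. Qed.

Lemma stab_inr X Y y :
  'C_G[inr y | gset_act (gset_union X Y)] = 'C_G[y | gset_act Y].
Proof. by apply/setP=> a; rewrite !mem_astab1. Qed.

Lemma stab_tagged (I : finType) (Z : I -> gset G) i (z : Z i) :
  'C_G[Tagged (fun i => Z i) z | gset_act (gset_bigunion Z)] =
  'C_G[z | gset_act (Z i)].
Proof. by apply/setP=> a; rewrite !mem_astab1 // eq_Tagged. Qed.

Lemma union_act_triv X Y g : (forall x, gset_act X x g = x) ->
  (forall y, gset_act Y y g = y) -> forall z, gset_act (gset_union X Y) z g = z.
Proof. by move=> trivX trivY [x | y]; rewrite /= (trivX, trivY). Qed.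

Lemma bigunion_act_triv (I : finType) (Z : I -> gset G) g :
    (forall i z, gset_act (Z i) z g = z) ->
  forall z, gset_act (gset_bigunion Z) z g = z.
Proof. by move=> trivZ [i z]; rewrite /= /bigunion_act /= trivZ. Qed.

End Stabilisers.

(** * Vanishing of f for all modules, by induction on the index of Q *)

Section NullModules.

Local Open Scope ring_scope.

Variables (F : fieldType) (p : nat) (gT : finGroupType).
Hypotheses (p_pr : prime p) (charF : p \in [pchar F]).
Implicit Types (G Q R C K L : {group gT}).

Definition cyclic_over G Q C := [&& Q \subset C, C \subset G & cyclic (C / Q)%g].

Lemma cyclic_over_mod G Q C : Q <| G -> p.-group Q ->
  cyclic_over G Q C -> cyclic_mod p C.
Proof.
move=> nsQG pQ /and3P[sQC sCG cycC].
case: p p_pr pQ => // p1 _ pQ; exists Q; split=> //.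
exact: normalS sQC sCG nsQG.
Qed.

Lemma cyclic_overJ G Q C g : Q <| G -> g \in G ->
  cyclic_over G Q (C :^ g)%G = cyclic_over G Q C.
Proof.
move=> nsQG Gg; have Ng := subsetP (normal_norm nsQG) g Gg.
rewrite /cyclic_over /= -{1}(normP Ng) conjSg -{1}(conjGid Gg) conjSg.
by rewrite quotientJ // cyclicJ.
Qed.

Lemma null_modules_p G Q : Q <| G -> p.-group Q -> null_modules F p G Q.
Proof.
have [m] := ubnP #|G : Q|; elim: m G Q => // m IHm G Q ltQG nsQG pQ.
(* For R strictly larger than Q the index of R in its normaliser is smaller than that of Q in G. *)
have null_norm R : Q \subset R -> R \subset G -> p.-group R -> (#|Q| < #|R|)%N ->
    null_modules F p 'N_G(R)%G R.
  move=> sQR sRG pR ltQR; apply: IHm => //; last exact: normalSG.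
  apply: leq_trans (ltnSE ltQG).
  have := Lagrange (subset_trans sQR sRG); have := Lagrange (normal_sub (normalSG sRG)).
  have := subset_leq_card (subsetIl G 'N(R)); rewrite /=.
  have := cardG_gt0 Q; have := cardG_gt0 'N_G(R).
  move: #|Q| #|R| #|G| #|'N_G(R)| #|G : Q| #|'N_G(R) : R| ltQR => q s g n' a b.
  move=> ltqs n_gt0 q_gt0 len defn defg; rewrite ltnNge; apply/negP => leab.
  have b_gt0 : (0 < b)%N by move: n_gt0; rewrite -defn muln_gt0 => /andP[].
  have : (s * b <= q * b)%N by rewrite defn (leq_trans len) // -defg leq_mul.
  by rewrite leq_pmul2r // leqNgt ltqs.
move=> V r repG trivQ e null_e; rewrite -/(null_dim e (fixv r)).
(* The family defining the auxiliary sets [X_ G M G] and [Y_ G M]. It may contain G itself, which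
   [card_fix_XY] allows. *)
pose cyc := [set C : {group gT} | cyclic_over G Q C].
pose M (i : 'I_#|cyc|) : {group gT} := enum_val i.
have cycM i : cyclic_over G Q (M i) by have := enum_valP i; rewrite inE.
have sMG i : M i \subset G by case/and3P: (cycM i).
have sQM i : Q \subset M i by case/and3P: (cycM i).
have cyc_cov C : cyclic_over G Q C -> exists i, C = M i.
  move=> cycC; have Cc : C \in cyc by rewrite inE.
  by exists (enum_rank_in Cc C); rewrite /M enum_rankK_in.
have sQM_ (S : {set 'I_#|cyc|}) : Q \subset M_ M S.
  by rewrite sub_M_; apply/forall_inP.
have sMG_ (S : {set 'I_#|cyc|}) : S != set0 -> M_ M S \subset G.
  by case/set0Pn=> i Si; apply: subset_trans (sMG i); apply: bigcap_inf.
have trivC K : Q \subset K -> {in Q, forall g (u : coset_gset G K),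
    gset_act (coset_gset G K) u g = u}.
  move=> sQK g Qg u; apply: val_inj; have Gg := subsetP (normal_sub nsQG) g Qg.
  rewrite coset_gsetE //; have /rcosetsP[x Gx ->] := valP u.
  rewrite -rcosetM; apply: rcoset_eqP; rewrite mem_rcoset.
  have -> : (x * g * x^-1 = g ^ x^-1)%g by rewrite conjgE invgK mulgA.
  by rewrite (subsetP sQK) // memJ_norm // groupV (subsetP (normal_norm nsQG)).
have trivX : {in Q, forall g x, gset_act (X_ G M G) x g = x}.
  move=> g Qg; apply: union_act_triv; apply: bigunion_act_triv => S.
    by apply: trivC; rewrite ?normal_sub.
  by apply: bigunion_act_triv => _; apply: trivC.
have trivY : {in Q, forall g y, gset_act (Y_ G M) y g = y}.
  move=> g Qg; apply: bigunion_act_triv => S.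
  by apply: bigunion_act_triv => _; apply: trivC.
(* The contribution to f(V tensor k[Z]) of one point of Z with stabiliser L. It is f(V) for L = G,
   and 0 for conjugates of the groups [M_ M S], which are cyclic mod p. *)
pose stab_sum (L : {set gT}) := \sum_(K : {group gT})
  e K * (#|K :&: L|%:Z * (\dim (fixv r (K :&: L)))%:Z).
have stab_sumG : stab_sum G = null_dim e (fixv r).
  apply: eq_bigr => K _; have [-> | /(proj1 null_e)[_ sKG]] := eqVneq (e K) 0.
    by rewrite !mul0r.
  by rewrite (setIidPl sKG).
have stab_sum0 (S : {set 'I_#|cyc|}) u : S != set0 ->
    stab_sum 'C_G[u | gset_act (coset_gset G (M_ M S))] = 0.
  move=> nzS; have [g Gg ->] := stab_coset u (sMG_ S nzS).
  have [i Si] := set0Pn _ nzS.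
  have sLG : (M_ M S :^ g)%G \subset G by rewrite -(conjGid Gg) conjSg sMG_.
  have cycL : cyclic_mod p (M_ M S :^ g)%G.
    apply: (@cyclic_modS _ _ _ (M i :^ g)%G).
      by rewrite conjSg; apply: bigcap_inf.
    by apply: (cyclic_over_mod nsQG pQ); rewrite cyclic_overJ.
  exact: (null_sum_restrict (fun K => (\dim (fixv r K))%:Z) null_e sLG cycL).
have eqFix : {in G, forall g, #|'Fix_(gset_act (X_ G M G))([set g])| =
    #|'Fix_(gset_act (Y_ G M))([set g])|}.
  move=> g Gg; apply: card_fix_XY => // [|h Gh _]; first by rewrite sub1set.
  have Ghg : (g ^ h)%g \in G by rewrite groupJ.
  have [|i defM] := cyc_cov (Q <*> <[(g ^ h)%g]>)%G.
    rewrite /cyclic_over joing_subl join_subG normal_sub // cycle_subG Ghg /=.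
    rewrite quotientYidl ?quotient_cyclic ?cycle_cyclic //.
    by rewrite cycle_subG (subsetP (normal_norm nsQG)).
  exists i; rewrite -defM conjg_set1 sub1set.
  by rewrite (subsetP (joing_subr _ _)) ?cycle_id.
(* All points of [Y_], and those of [X_] outside the copies of G/G, contribute 0; each point of
   these copies contributes f(V). *)
have := null_dim_perm_eq p_pr charF nsQG pQ null_e null_norm repG trivQ trivX trivY eqFix.
rewrite !(null_dim_permE _ null_e repG).
rewrite [RHS]big1 => [|[S [i u]] _]; last first.
  by rewrite !stab_tagged; apply: stab_sum0; case/andP: (valP S).
pose f z := stab_sum 'C_G[z | gset_act (X_ G M G)].
rewrite (_ : \sum_z _ = \sum_x f (inl x) + \sum_y f (inr y)); last first.
  exact: big_sumType.
rewrite [X in _ + X]big1 ?addr0 /f => [|[S [i u]] _]; last first.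
  rewrite stab_inr !stab_tagged; apply: stab_sum0.
  by case/andP: (valP S).
rewrite (eq_bigr (fun=> null_dim e (fixv r))) => [|[i u] _]; last first.
  rewrite stab_inl !stab_tagged; have [g Gg ->] := stab_coset u (subxx G).
  by rewrite (conjGid Gg).
rewrite sumr_const => /eqP; rewrite mulrn_eq0 => /orP[/eqP | /eqP //].
(* A point of the copies of G/G is exhibited, so that the multiple of f(V) found to vanish is a
   nonzero one. *)
have u0 : coset_gset G G.
  by exists (G : {set gT}); apply/rcosetsP; exists 1%g; rewrite ?rcoset1.
have z0 : gset_copies #|G| (coset_gset G G).
  by exists (Ordinal (cardG_gt0 G)); apply: u0.
by move/card0_eq/(_ z0).
Qed.

End NullModules.

(** * From equivariant maps to isomorphisms *)

Section StabiliserWeights.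

Local Open Scope ring_scope.

Variables (p : nat) (gT : finGroupType) (G : {group gT}) (X Y : finType).
Variables (toX : action G X) (toY : action G Y).
Implicit Types (K C : {group gT}).

Definition stab_weight K : int :=
  (#|[set x | 'C_G[x | toX]%G == K]|%:Z - #|[set y | 'C_G[y | toY]%G == K]|%:Z).

Lemma sum_stab_weight (P : pred {group gT}) (phi : {group gT} -> int) :
  \sum_(K : {group gT} | P K) stab_weight K * phi K =
  \sum_(x | P 'C_G[x | toX]%G) phi 'C_G[x | toX]%G
    - \sum_(y | P 'C_G[y | toY]%G) phi 'C_G[y | toY]%G.
Proof.
have sumE (I : finType) (to : action G I) :
    \sum_(K : {group gT} | P K) #|[set z | 'C_G[z | to]%G == K]|%:Z * phi K =
    \sum_(z | P 'C_G[z | to]%G) phi 'C_G[z | to]%G.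
  rewrite [RHS](partition_big (fun z => 'C_G[z | to]%G) P) //=.
  apply: eq_bigr => K PK; rewrite -sum1_card (big_morph Posz PoszD (erefl _)).
  rewrite mulr_suml; apply: eq_big => [z | z].
    by rewrite inE; apply/esym/andb_idl => /eqP ->.
  by rewrite inE => /eqP ->; rewrite mul1r.
by under eq_bigr do rewrite mulrBl; rewrite sumrB !sumE.
Qed.

Lemma sub_stab_afix (C : {set gT}) (I : finType) (to : action G I) z : C \subset G ->
  (C \subset 'C_G[z | to]) = (z \in 'Fix_to(C)).
Proof.
move=> sCG; rewrite inE; apply/subsetP/subsetP=> sC c Cc; have := sC c Cc.
  by rewrite mem_astab1 // inE => /andP[].
by rewrite mem_astab1 // inE (subsetP sCG).
Qed.

Lemma null_stab_weight :
    (forall C, C \subset G -> cyclic_mod p C -> #|'Fix_toX(C)| = #|'Fix_toY(C)|) ->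
  null_weight p G 1%G stab_weight.
Proof.
move=> eqFix; split=> [K nzK | C sCG cycC].
  rewrite sub1G; split=> //; apply: contraNT nzK => nsKG.
  have empty (I : finType) (to : action G I) :
      [set z | 'C_G[z | to]%G == K] = set0.
    apply/setP=> z; rewrite !inE; apply: contraNF nsKG => /eqP <-.
    exact: subsetIl.
  by rewrite /stab_weight !empty !cards0 subrr.
under eq_bigr do rewrite -[stab_weight _]mulr1.
rewrite (sum_stab_weight _ (fun=> 1)).
rewrite (eq_bigl (mem 'Fix_toX(C))) => [|x]; last exact: sub_stab_afix.
rewrite [X in _ - X](eq_bigl (mem 'Fix_toY(C))) => [|y]; last exact: sub_stab_afix.
by rewrite !sumr_const eqFix // subrr.
Qed.

End StabiliserWeights.

Section EquivariantMaps.

Local Open Scope ring_scope.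

Variables (F : fieldType) (gT : finGroupType) (G : {group gT}).
Variables (V : vectType F) (r : gT -> 'End(V)) (I : finType) (to : action G I).
Hypothesis repG : is_rep G r.

(** The functions fixed by G under [perm_rep] are exactly the equivariant maps from I to V. *)
Definition equiv_maps (S : {vspace V}) : {vspace {ffun I -> V}} :=
  (fixv (perm_rep r to) G :&: \bigcap_z (linfun (eval_fun z) @^-1: S))%VS.

Lemma equiv_mapsP (S : {vspace V}) (u : {ffun I -> V}) : reflect
  ({in G, forall g z, u (to z g) = r g (u z)} /\ (forall z, u z \in S))
  (u \in equiv_maps S).
Proof.
apply: (iffP memv_capP) => -[fixu uS]; split; try exact/(fixv_permP r to u (subxx G)).
  move=> z; move: uS; rewrite memvE => /subv_bigcapP/(_ z isT).
  by rewrite -memvE -memv_preim lfunE.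
rewrite memvE; apply/subv_bigcapP=> z _.
by rewrite -memvE -memv_preim lfunE /=; apply: uS.
Qed.

Lemma dim_equiv_maps (S : {vspace V}) :
    {in G, forall g v, v \in S -> r g v \in S} ->
  (#|G| * \dim (equiv_maps S) =
   \sum_z #|'C_G[z | to]| * \dim (S :&: fixv r 'C_G[z | to]))%N.
Proof.
move=> stabS.
pose incl (u : {ffun I -> subvs_of S}) : {ffun I -> V} := [ffun z => vsval (u z)].
have incl_lin : linear incl by move=> c u v; apply/ffunP=> z; rewrite !ffunE.
pose inclL := GRing.isLinear.Build F _ _ *:%R incl incl_lin.
pose dL : {linear {ffun I -> subvs_of S} -> {ffun I -> V}} := HB.pack incl inclL.
have dE u z : linfun dL u z = vsval (u z) by rewrite lfunE /= ffunE.
have repS := is_rep_sub repG stabS.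
have -> : (equiv_maps S = linfun dL @: fixv (perm_rep (sub_rep r S) to) G)%VS.
  apply/vspaceP=> u; apply/equiv_mapsP/memv_imgP.
    case=> fixu uS; exists [ffun z => vsproj S (u z)]; last first.
      by apply/ffunP=> z; rewrite dE ffunE vsprojK.
    apply/fixv_permP => // g Gg z; apply: subvs_inj.
    by rewrite !ffunE (sub_repE stabS) // !vsprojK ?fixu // stabS.
  case=> w /fixv_permP fixw ->; split=> [g Gg z | z]; rewrite !dE ?subvsP //.
  by rewrite fixw // (sub_repE stabS).
rewrite limg_dim_eq.
  rewrite (dim_fixv_perm to repS (subxx G)); apply: eq_bigr => z _.
  by rewrite (dim_fixv_sub stabS (K := 'C_G[z | to]%G)) ?subsetIl.
apply/eqP; rewrite -subv0; apply/subvP=> u /memv_capP[_]; rewrite memv_ker memv0.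
move=> /eqP/ffunP u0; apply/eqP/ffunP=> z; apply: subvs_inj.
by have := u0 z; rewrite dE !ffunE.
Qed.

End EquivariantMaps.

(** * Counting equivariant maps over F_p *)

Section SpanningMaps.

Local Open Scope ring_scope.

Variables (p : nat) (gT : finGroupType) (G : {group gT}).
Hypothesis p_pr : prime p.
Variables (X Y : finType) (toX : action G X) (toY : action G Y).
Hypothesis eqFix : forall C : {group gT}, C \subset G -> cyclic_mod p C ->
  #|'Fix_toX(C)| = #|'Fix_toY(C)|.
Variables (n : nat) (r : gT -> 'End('rV['F_p]_n)).
Hypothesis repG : is_rep G r.

Notation V := 'rV['F_p]_n.

(** Over a finite field it suffices to compare dimensions. By [dim_equiv_maps], [#|G|] times their
    difference is the sum attached to [stab_weight] and the module S, which vanishes by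
    [null_modules_p] with Q = 1. *)
Lemma card_equiv_maps (S : {vspace V}) :
    {in G, forall g v, v \in S -> r g v \in S} ->
  #|[set u | u \in equiv_maps r toX S]| = #|[set u | u \in equiv_maps r toY S]|.
Proof.
move=> stabS; have charF := pchar_Fp p_pr.
rewrite !cardsE !card_vspace; congr (_ ^ _)%N.
apply/eqP; rewrite -(eqn_pmul2l (cardG_gt0 G)) -eqz_nat.
rewrite !dim_equiv_maps // !(big_morph Posz PoszD (erefl _)) -subr_eq0; apply/eqP.
pose phi (K : {group gT}) : int := #|K|%:Z * (\dim (S :&: fixv r K))%:Z.
have nullG : null_modules 'F_p p G 1%G.
  by apply: null_modules_p; rewrite ?normal1 ?pgroup1.
have triv1 : {in 1%G, forall g v, v \in S -> r g v = v}.
  by move=> g /set1P -> v _; rewrite (rep1 repG).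
have := null_submodule nullG (sub1G G) repG stabS triv1 (null_stab_weight eqFix).
by rewrite (sum_stab_weight toX toY xpredT phi).
Qed.

Definition spanned (I : finType) (u : {ffun I -> V}) : {vspace V} :=
  (\sum_z <[u z]>)%VS.

Lemma spanned_sub (I : finType) (u : {ffun I -> V}) (S : {vspace V}) :
  (spanned u <= S)%VS = [forall z, u z \in S].
Proof.
apply/subv_sumP/forallP=> [sS z | uS z _]; last by rewrite -memvE.
by rewrite memvE sS.
Qed.

(** The span is recorded as a set of vectors, so that sums and induction over the possible spans
    range over a finite type. *)
Definition spanning (I : finType) (to : action G I) (T : {set V}) :=
  [set u : {ffun I -> V} | (u \in fixv (perm_rep r to) G)
                           && ([set v | v \in spanned u] == T)].

(* Inclusion-exclusion on the submodule spanned by the values. *)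
Lemma card_spanning T : #|spanning toX T| = #|spanning toY T|.
Proof.
have [m] := ubnP #|T|; elim: m T => // m IHm T leTm.
have stab_spanned (I : finType) (to : action G I) u : u \in spanning to T ->
    exists2 S : {vspace V}, {in G, forall g v, v \in S -> r g v \in S} &
      [set v | v \in S] = T.
  rewrite inE => /andP[/fixv_permP fixu /eqP defT]; exists (spanned u) => // g Gg v.
  have : (spanned u <= (r g @^-1: spanned u))%VS.
    rewrite spanned_sub; apply/forallP=> z; rewrite -memv_preim -fixu //.
    by have := subvv (spanned u); rewrite spanned_sub => /forallP.
  by move/subvP/[apply]; rewrite -memv_preim.
(* The values of an equivariant map span a submodule, so either T is a submodule or both sets are
   empty. *)
suff [] : (exists2 S : {vspace V}, {in G, forall g v, v \in S -> r g v \in S} &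
      [set v | v \in S] = T) \/ (spanning toX T = set0 /\ spanning toY T = set0).
- case=> S stabS defT.
  have sumE (I : finType) (to : action G I) :
      #|[set u | u \in equiv_maps r to S]| =
      (#|spanning to T| + \sum_(T' : {set V} | T' \proper T) #|spanning to T'|)%N.
    have inner (T' : {set V}) : T' \subset T ->
        (\sum_(u in [set u | u \in equiv_maps r to S] |
           [set v | v \in spanned u] == T') 1)%N = #|spanning to T'|.
      move=> sT'T; rewrite -sum1_card; apply: eq_bigl => u; rewrite !inE.
      apply: andb_id2r => /eqP defT';
      apply/equiv_mapsP/(fixv_permP r to u (subxx G)) => [[]//|fixu].
      split=> // z; suff : u z \in [set v | v \in S] by rewrite inE.
      rewrite defT (subsetP sT'T) // -defT' inE.
      by have := subvv (spanned u); rewrite spanned_sub => /forallP.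
    rewrite -sum1_card.
    rewrite (partition_big (fun u => [set v | v \in spanned u])
      (fun T' : {set V} => T' \subset T)) /=; last first.
      move=> u; rewrite inE => /equiv_mapsP[_ uS]; rewrite -defT.
      apply/subsetP=> v; rewrite !inE; apply/subvP.
      by rewrite spanned_sub; apply/forallP.
    rewrite (bigD1 T) //= inner //; congr (_ + _)%N.
    apply: eq_big => [T' | T' /andP[sT'T _]]; first by rewrite properEneq andbC.
    exact: inner.
  have := card_equiv_maps stabS; rewrite !sumE.
  rewrite [in RHS](eq_bigr (fun T' => #|spanning toX T'|)) => [/addIn //|T' ltT'].
  by rewrite IHm // (leq_trans (proper_card ltT')).
- by case=> -> ->; rewrite !cards0.
have [X0 | [u Xu]] := set_0Vmem (spanning toX T); last by left; apply: stab_spanned Xu.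
have [Y0 | [u Yu]] := set_0Vmem (spanning toY T); last by left; apply: stab_spanned Yu.
by right.
Qed.

End SpanningMaps.

Lemma cyclic_cyclic_mod p (gT : finGroupType) (C : {group gT}) :
  cyclic C -> cyclic_mod p C.
Proof.
case: p => // p cycC; exists 1%G; split; rewrite ?normal1 ?pgroup1 //.
exact: quotient_cyclic.
Qed.

(** Let V be the permutation module of Y over F_p. Its basis is a spanning equivariant map from Y,
    so [card_spanning] yields one, u, from X. The square matrix with rows [u (bX i)] has full rank;
    its entries are lifted to integers one by one, which keeps it an intertwiner by
    [map_intertwiner]. *)
Lemma modular_intertwiner p (gT : finGroupType) (G : {group gT}) (X Y : finType)
    (toX : action G X) (toY : action G Y) n (bX : 'I_n -> X) (bY : 'I_n -> Y) :
    prime p -> bijective bX -> bijective bY ->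
    (forall C : {group gT}, C \subset G -> cyclic_mod p C ->
       #|'Fix_toX(C)| = #|'Fix_toY(C)|) ->
  exists2 M : 'M[int]_n, ~~ (p %| (\det M)%R)%Z & intertwines toX toY bX bY M.
Proof.
move=> p_pr bijX bijY eqFix; have charF := pchar_Fp p_pr.
have [aX bXK aXK] := bijX; have [aY bYK aYK] := bijY.
pose r g : 'End('rV['F_p]_n) := linfun (mulmxr (act_mx toY bY 'F_p g)).
have rE g v : r g v = (v *m act_mx toY bY 'F_p g)%R by rewrite lfunE.
have triv1 : {in [1 gT], forall g y, toY y g = y}.
  by move=> g /set1P -> y; rewrite act1.
have [Y1 YM _] := is_mxrep_act bijY 'F_p triv1.
have repG : is_rep G r.
  split=> [|g h Gg Gh]; apply/lfunP=> v; first by rewrite rE Y1 mulmx1 id_lfunE.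
  by rewrite comp_lfunE !rE YM // mulmxA.
have [u] : exists u, u \in spanning r toX setT.
  apply/set0Pn; rewrite -card_gt0 (card_spanning p_pr eqFix repG) card_gt0.
  apply/set0Pn; exists [ffun y => delta_mx 0 (aY y)]%R.
  rewrite inE; apply/andP; split; last first.
    rewrite -subTset; apply/subsetP=> v _; rewrite inE (row_sum_delta v).
    apply: memv_suml => j _; apply: memvZ.
    rewrite (subvP (sumv_sup (bY j) _ (subvv _))) // ffunE bYK memv_line //.
  apply/fixv_permP => // g Gg y; rewrite !ffunE rE -rowE; apply/rowP=> j.
  by rewrite !mxE /= aYK eq_sym (can2_eq aYK bYK).
rewrite inE => /andP[/(fixv_permP r toX u (subxx G)) fixu /eqP spanu].
pose B : 'M['F_p]_n := (\matrix_i u (bX i))%R.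
have XB : intertwines toX toY bX bY B.
  move=> g Gg; apply/matrixP=> i j.
  have bXi : bX (aX (toX (bX i) g)) = toX (bX i) g by [].
  rewrite (act_mx_mulE bijX _ _ bXi) mxE bXi fixu // rE !mxE.
  by apply: eq_bigr => l _; rewrite !mxE.
have uB : B \in unitmx.
  rewrite -row_full_unit -sub1mx submxE; apply/eqP/row_matrixP=> i.
  rewrite row_mul row0; 
  pose K : {vspace 'rV['F_p]_n} := lker (linfun (mulmxr (cokermx B))).
  have memK (v : 'rV_n) : (v \in K) = (v *m cokermx B == 0)%R by rewrite memv_ker lfunE.
  apply/eqP; rewrite -memK; have : row i 1%:M%R \in [set v | v \in spanned u].
    by rewrite spanu inE.
  rewrite inE; apply/subvP; rewrite spanned_sub; apply/forallP=> x.
  rewrite memK -(aXK x) -submxE.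
  have <- : row (aX x) B = u (bX (aX x)) by rewrite rowK.
  exact: row_sub.
exists (map_mx (fun a : 'F_p => Posz a) B); last exact: map_intertwiner.
rewrite -(intr_pdvd charF) -det_map_mx.
suff -> : map_mx intr (map_mx (fun a : 'F_p => Posz a) B) = B.
  by rewrite -unitfE -unitmxE.
by apply/matrixP=> i j; rewrite !mxE -pmulrn natr_Zp.
Qed.

(** * From intertwining matrices to linear equivalence *)

Lemma linearly_equivalent_mx (k : fieldType) (gT : finGroupType) (G : {group gT})
    (X Y : gset G) n (bX : 'I_n -> X) (bY : 'I_n -> Y) (M : 'M[k]_n) :
    bijective bX -> bijective bY -> M \in unitmx ->
    intertwines (gset_act X) (gset_act Y) bX bY M ->
  linearly_equivalent k X Y.
Proof.
move=> [aX bXK aXK] [aY bYK aYK] uM XM.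
pose coord (Z : gset G) (b : 'I_n -> Z) (f : {ffun Z -> k^o}) : 'rV[k]_n :=
  (\row_i f (b i))%R.
pose phi (f : {ffun X -> k^o}) : {ffun Y -> k^o} :=
  [ffun y => (coord X bX f *m M)%R 0%R (aY y)].
have phi_lin : linear phi.
  move=> c f f'; apply/ffunP=> y; rewrite !ffunE.
  have -> : (coord X bX (c *: f + f') = c *: coord X bX f + coord X bX f')%R.
    by apply/rowP=> i; rewrite !mxE !ffunE.
  by rewrite mulmxDl -scalemxAl !mxE.
pose phiL := GRing.isLinear.Build k _ _ *:%R%R phi phi_lin.
pose dL : {linear {ffun X -> k^o} -> {ffun Y -> k^o}} := HB.pack phi phiL.
pose psi (f : {ffun Y -> k^o}) : {ffun X -> k^o} :=
  [ffun x => (coord Y bY f *m invmx M)%R 0%R (aX x)].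
have coord_phi f : coord Y bY (phi f) = (coord X bX f *m M)%R.
  by apply/rowP=> j; rewrite mxE ffunE bYK.
have coord_psi f : coord X bX (psi f) = (coord Y bY f *m invmx M)%R.
  by apply/rowP=> j; rewrite mxE ffunE bXK.
exists dL.
  exists psi => f; apply/ffunP=> z; rewrite ffunE.
    by rewrite coord_phi mulmxK // mxE aXK.
  by rewrite coord_psi mulmxKV // mxE aYK.
move=> g f Gg; apply/ffunP=> y; rewrite ![in LHS]ffunE [RHS]ffunE [RHS]ffunE.
have actX : coord X bX (perm_mod_act f g) =
    (coord X bX f *m act_mx (gset_act X) bX k g)%R.
  apply/rowP=> j.
  have bXj : bX j = gset_act X (bX (aX (gset_act X (bX j) g^-1))) g.
    by rewrite aXK -actMin ?groupV // mulVg act1.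
  rewrite (mul_act_mxE (Bijective bXK aXK) _ _ Gg bXj) !mxE ffunE.
  by rewrite aXK.
rewrite actX -mulmxA XM // mulmxA.
have bYy : bY (aY y) = gset_act Y (bY (aY (gset_act Y y g^-1))) g.
  by rewrite !aYK -actMin ?groupV // mulVg act1.
by rewrite (mul_act_mxE (Bijective bYK aYK) _ _ Gg bYy).
Qed.

(** An integral intertwiner whose determinant is nonzero in k is enough, since it can be mapped into
    any field of characteristic p. It comes from characters for p = 0 and from spanning maps over
    F_p for p prime. *)
Lemma linearly_equivalent_fix (k : fieldType) (p : nat) (gT : finGroupType)
    (G : {group gT}) (X Y : gset G) :
    has_characteristic k p ->
    (forall C : {group gT}, C \subset G -> cyclic_mod p C ->
       #|'Fix_(gset_act X)(C)| = #|'Fix_(gset_act Y)(C)|) ->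
  linearly_equivalent k X Y.
Proof.
move=> char_k eqFix.
have cyc1 : cyclic_mod p (1%G : {group gT}).
  apply: cyclic_cyclic_mod; exact: cyclic1.
have cardFix1 (Z : gset G) : #|'Fix_(gset_act Z)(1%G)| = #|Z|.
  rewrite -cardsT; apply: eq_card => z; rewrite !inE.
  by apply/subsetP=> g /set1P ->; rewrite inE act1.
have eqXY : #|X| = #|Y| by rewrite -!cardFix1 eqFix ?sub1G.
have bijX : bijective (fun i : 'I_#|X| => enum_val i : X).
  exact: enum_val_bij.
have bijY : bijective (fun i : 'I_#|X| => enum_val (cast_ord eqXY i) : Y).
  apply: bij_comp (@enum_val_bij Y) _.
  by exists (cast_ord (esym eqXY)); [apply: cast_ordK | apply: cast_ordKV].
suff [M nzM XM] : exists2 M : 'M[int]_#|X|, ((\det M)%:~R != 0 :> k)%R &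
    intertwines (gset_act X) (gset_act Y) (fun i => enum_val i)
      (fun i => enum_val (cast_ord eqXY i)) M.
  apply: (@linearly_equivalent_mx k _ _ X Y _ _ _ (map_mx intr M) bijX bijY).
    by rewrite unitmxE det_map_mx unitfE.
  exact: map_intertwiner.
case: p => [|p] in char_k eqFix cyc1 *.
  have eqFix1 : {in G, forall g, #|'Fix_(gset_act X)([set g])| =
      #|'Fix_(gset_act Y)([set g])|}.
    move=> g Gg; have afix_cycle (Z : gset G) :
        #|'Fix_(gset_act Z)([set g])| = #|'Fix_(gset_act Z)(<[g]>)|.
      apply: eq_card => z; rewrite -!sub_stab_afix ?sub1set ?cycle_subG //.
    rewrite !afix_cycle; apply: (eqFix <[g]>%G); first by rewrite cycle_subG.
    exact: cycle_cyclic.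
  have [M nzM XM] := integral_intertwiner bijX bijY eqFix1.
  exists M => //; rewrite [(\det M)%R]intEsign rmorphM rmorph_sign mulf_eq0.
  rewrite signr_eq0 /= -pmulrn; have /pcharf0P -> := char_k.
  by rewrite absz_eq0.
have p_pr : prime p.+1 by case/andP: char_k.
have [M pM XM] := modular_intertwiner p_pr bijX bijY eqFix.
by exists M => //; rewrite (intr_pdvd char_k).
Qed.
Theorem theorem2p3 (k : fieldType) (p : nat) (char_k : has_characteristic k p)
    (gT : finGroupType) (G : {group gT})
    (l : nat) (M : 'I_l -> {group gT}) (M_inj : injective M)
    (sMG : forall i, M i \subset G)
    (H : {group gT}) (defH : H = \bigcup_(i < l) M i :> {set gT})
    (ltMH : forall i, M i \proper H)
    (covH : forall C : {group gT},
       C \subset H -> cyclic_mod p C -> exists i, C \subset M i) :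
  linearly_equivalent k (X_ G M H) (Y_ G M).
Proof.
have sMH i : M i \subset H by apply: proper_sub.
have sHG : H \subset G by rewrite defH; apply/bigcupsP=> i _.
apply: (linearly_equivalent_fix char_k) => C sCG cycC.
apply: card_fix_XY => // g Gg sCgH.
exact: (covH (C :^ g)%G sCgH (cyclic_modJ g cycC)).
Qed.
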